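(* Let $\mathcal O=\mathcal{C}l(s,t)$ with $s+t>1$, $k=2^{s+t}$, $n\in\mathbb N$, and let $M$ be a smooth $kn$-dimensional manifold equipped with a $G$-structure $\pi:P\to M$ with $G=GL(n,\mathcal O)$, i.e. an almost Clifford manifold. Let $\mathbb V=\mathbb R^{kn}$, let $\mathfrak g$ be the Lie algebra of $G$, and let $\mathcal D$ be a $G$-invariant complement of $\partial(\mathfrak g\otimes\mathbb V^* )$ in $\mathbb V\otimes\wedge^2\mathbb V^*$. Then the $G$-structure is of type $1$, and there exists a unique $\mathcal D$-connection on it.
   Context: The Clifford algebra $\mathcal O=\mathcal{C}l(s,t)$ is the real associative unital algebra of dimension $k=2^{s+t}$ generated by pairwise anticommuting elements $I_1,\dots,I_t$ with $I_i^2=-E$ and $J_1,\dots,J_s$ with $J_j^2=E$, $E$ the unit. It acts on $\mathbb R^{kn}=\mathcal O^n$ blockwise through a matrix representation, and $$GL(n,\mathcal O)=\{B\in GL(kn,\mathbb R): BI_i=I_iB,\ BJ_j=J_jB\ \text{for all } i,j\}.$$ A $G$-structure on $M$ is a reduction of the frame bundle $P^1M$ to a subgroup $G\subset GL(\dim M,\mathbb R)$. For $\mathfrak g\subset\mathfrak{gl}(\mathbb V)$, the first prolongation $\mathfrak g^{(1)}$ is the space of symmetric bilinear maps $\tau:\mathbb V\times\mathbb V\to\mathbb V$ such that for each fixed $v_1\in\mathbb V$ the map $v\mapsto \tau(v,v_1)$ is in $\mathfrak g$. A linear Lie group, and any $G$-structure with it as structure group, is of type $1$ if $\mathfrak g^{(1)}=0$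 and $\mathfrak g^{(0)}=\mathfrak g\ne0$. $\partial:\mathfrak g\otimes\mathbb V^*=\mathrm{Hom}(\mathbb V,\mathfrak g)\to\mathbb V\otimes\wedge^2\mathbb V^*$ is the Spencer operator of alternation. Given a $G$-invariant decomposition $\mathbb V\otimes\wedge^2\mathbb V^*=\partial(\mathfrak g\otimes\mathbb V^* )\oplus\mathcal D$, a connection $\omega$ on $P$ is a $\mathcal D$-connection if its torsion function $t^\omega:P\to\mathbb V\otimes\wedge^2\mathbb V^*$ has values in $\mathcal D$. *)

(* Defs.v *)
From HB Require Import structures.
From mathcomp Require Import all_boot all_order all_algebra all_field.
From mathcomp Require Import mxtens.
From mathcomp Require Import all_classical all_reals all_analysis.
Set Implicit Arguments.
Unset Strict Implicit.
Unset Printing Implicit Defensive.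
Import Order.TTheory GRing.Theory Num.Theory.
Import numFieldNormedType.Exports.
Local Open Scope classical_set_scope.
Local Open Scope ring_scope.

Record is_clifford (R : fieldType) (A : falgType R) (s t : nat)
    (I : 'I_t -> A) (J : 'I_s -> A) : Prop := IsClifford {
  clifford_dim : \dim {:A} = (2 ^ (s + t))%N;
  clifford_gen :
    agenv <<[seq I i | i : 'I_t] ++ [seq J j | j : 'I_s]>>%VS = {:A}%VS;
  clifford_sqI : forall i, I i * I i = -1;
  clifford_sqJ : forall j, J j * J j = 1;
  clifford_anticommI : forall i i', i != i' -> I i * I i' = - (I i' * I i);
  clifford_anticommJ : forall j j', j != j' -> J j * J j' = - (J j' * J j);
  clifford_anticommIJ : forall i j, I i * J j = - (J j * I i) }.

Definition lmul_mx (R : fieldType) (A : falgType R) (k : nat)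
    (e : k.-tuple A) (a : A) : 'M[R]_k :=
  \matrix_(i, j) coord e i (a * e`_j).

(* The Kronecker product [1%:M *t B] is the block diagonal matrix with [n]
   copies of [B]: it is the action of [a] on A^n, where A is identified with
   R^k by means of the basis [e]. *)
Definition clifford_act (R : fieldType) (A : falgType R) (k : nat)
    (e : k.-tuple A) (n : nat) (a : A) : 'M[R]_(n * k) :=
  (1%:M : 'M[R]_n) *t lmul_mx e a.

Definition GL_clifford (R : fieldType) (A : falgType R) (s t k : nat)
    (I : 'I_t -> A) (J : 'I_s -> A) (e : k.-tuple A) (n : nat) :
    set 'M[R]_(n * k) :=
  [set B | [/\ B \in unitmx,
     forall i, B *m clifford_act e n (I i) = clifford_act e n (I i) *m B &
     forall j, B *m clifford_act e n (J j) = clifford_act e n (J j) *m B]].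

Arguments GL_clifford {R A s t k} I J e n _.

(* Both notions are only meant for open [U]. *)
Fixpoint Ck_on (R : realType) (E F : normedModType R) (k : nat) (U : set E)
    (f : E -> F) : Prop :=
  match k with
  | 0%N => forall x, U x -> {for x, continuous f}
  | k'.+1 => (forall x, U x -> differentiable f x) /\
             (forall v, Ck_on k' U ('D_v f))
  end.

Definition smooth_on (R : realType) (E F : normedModType R) (U : set E)
  (f : E -> F) : Prop := forall k, Ck_on k U f.

Section LinearGroups.
Variables (R : realType) (m : nat).
Implicit Types (G g : set 'M[R]_m) (D : set ('cV[R]_m -> 'cV[R]_m -> 'cV[R]_m)).

Definition curve_at1 G (a : R^o -> 'M[R]_m) : Prop :=
  a 0 = 1%:M /\ exists W : set R^o,
    [/\ open W, W 0, smooth_on W a & forall x, W x -> G (a x)].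

(* T_1 G, as the set of initial velocities of smooth curves *)
Definition lie_algebra G : set 'M[R]_m :=
  [set 'D_(1 : R^o) a 0 | a in curve_at1 G].

Definition bilinear_map (b : 'cV[R]_m -> 'cV[R]_m -> 'cV[R]_m) : Prop :=
  (forall v, linear (b v)) /\ (forall w, linear (b ^~ w)).

Definition first_prolongation g :
    set ('cV[R]_m -> 'cV[R]_m -> 'cV[R]_m) :=
  [set b | [/\ bilinear_map b, forall v w, b v w = b w v &
     forall v1, exists2 X, g X & forall v, b v v1 = X *m v]].

Definition of_type1 G : Prop :=
  first_prolongation (lie_algebra G) = [set 0] /\
  lie_algebra G <> [set 0].

(* V (x) /\^2 V^* *)
Definition alternating2 : set ('cV[R]_m -> 'cV[R]_m -> 'cV[R]_m) :=
  [set b | bilinear_map b /\ forall v, b v v = 0].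

Definition Hom_to g : set ('cV[R]_m -> 'M[R]_m) :=
  [set S | linear S /\ forall v, g (S v)].

Definition spencer (S : 'cV[R]_m -> 'M[R]_m) :
    'cV[R]_m -> 'cV[R]_m -> 'cV[R]_m :=
  fun v w => S v *m w - S w *m v.

Record invariant_complement G D : Prop := InvariantComplement {
  ic_sub : D `<=` alternating2;
  ic_0 : D 0;
  ic_linear : forall (a : R) b b', D b -> D b' -> D (a *: b + b');
  ic_sum : alternating2 =
    [set b + d | b in spencer @` Hom_to (lie_algebra G) & d in D];
  ic_direct : spencer @` Hom_to (lie_algebra G) `&` D = [set 0];
  ic_invariant : forall B b, G B -> D b ->
    D (fun v w => B *m b (invmx B *m v) (invmx B *m w)) }.

End LinearGroups.

Record smoothManifold (R : realType) (m : nat) := SmoothManifold {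
  carrier :> topologicalType;
  atlas : Type;
  dom : atlas -> set carrier;
  chart : atlas -> carrier -> 'cV[R]_m;
  chartV : atlas -> 'cV[R]_m -> carrier;
  mfd_hausdorff : hausdorff_space carrier;
  mfd_countable : second_countable (T := carrier);
  dom_open : forall c, open (dom c);
  codom_open : forall c, open (chart c @` dom c);
  chartK : forall c x, dom c x -> chartV c (chart c x) = x;
  chart_continuous : forall c x, dom c x -> {for x, continuous (chart c)};
  chartV_continuous : forall c x, dom c x ->
    {for chart c x, continuous (chartV c)};
  dom_cover : forall x, exists c, dom c x;
  chart_compatible : forall c c',
    smooth_on (chart c @` (dom c `&` dom c')) (chart c' \o chartV c) }.

Section FrameBundle.
Variables (R : realType) (m : nat) (M : smoothManifold R m).

(* A tangent vector at x is given by its components in all the charts around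
   x; the components in the other charts are set to 0. *)
Definition tangent (x : M) : set (atlas M -> 'cV[R]_m) :=
  [set X | (forall c, ~ dom c x -> X c = 0) /\
     forall c c', dom c x -> dom c' x ->
       X c' = 'd (chart c' \o chartV c) (chart c x) (X c)].

(* [p] stands for the linear map from R^m to the tangent space at [p.1] whose
   matrix in the chart [c] is [p.2 c]. *)
Definition preframe : Type := M * (atlas M -> 'M[R]_m).

Definition frame_map (p : preframe) (v : 'cV[R]_m) : atlas M -> 'cV[R]_m :=
  fun c => p.2 c *m v.

Definition frame_bundle : set preframe :=
  [set p | set_bij setT (tangent p.1) (frame_map p)].

Definition frame_act (p : preframe) (B : 'M[R]_m) : preframe :=
  (p.1, fun c => p.2 c *m B).

(* the chart of the frame bundle induced by the chart [c] of M *)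
Definition frame_chart (c : atlas M) (p : preframe) :
  'cV[R]_m * 'M[R]_m := (chart c p.1, p.2 c).

Definition smooth_frames (E : normedModType R) (W : set E)
    (f : E -> preframe) : Prop :=
  [/\ forall w, W w -> frame_bundle (f w),
      forall w, W w -> {for w, continuous (fst \o f)} &
      forall c, smooth_on (W `&` [set w | dom c (f w).1]) (frame_chart c \o f)].

(* Tangent vectors of the frame bundle are likewise given by their components
   in the charts [frame_chart c]. *)
Definition frame_tangent : Type := atlas M -> 'cV[R]_m * 'M[R]_m.

Definition pushforward (E : normedModType R) (f : E -> preframe) (w v : E) :
    frame_tangent :=
  fun c => if `[< dom c (f w).1 >] then 'D_v (frame_chart c \o f) w else 0.

(* the differential of [frame_act ^~ B] *)
Definition frame_tangent_act (X : frame_tangent) (B : 'M[R]_m) :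
  frame_tangent := fun c => ((X c).1, (X c).2 *m B).

Record G_structure (G : set 'M[R]_m) (P : set preframe) : Prop := GStructure {
  gs_frames : P `<=` frame_bundle;
  gs_act : forall p B, P p -> G B -> P (frame_act p B);
  gs_trans : forall p q, P p -> P q -> p.1 = q.1 ->
    exists2 B, G B & q = frame_act p B;
  gs_section : forall x : M, exists (U : set M) (sigma : M -> preframe),
    [/\ open U, U x, forall y, U y -> P (sigma y) /\ (sigma y).1 = y &
        forall c, smooth_frames (chart c @` (U `&` dom c))
                                (sigma \o chartV c)] }.

Definition tangent_P (P : set preframe) (p : preframe) : set frame_tangent :=
  [set X | exists (W : set R^o) (gamma : R^o -> preframe),
     [/\ [/\ open W, W 0, smooth_frames W gamma & gamma 0 = p],
         forall x, W x -> P (gamma x) &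
         X = pushforward gamma 0 (1 : R^o)]].

(* A 1-form on P is a function [omega] of which only the values [omega p X],
   for p in P and X tangent to P at p, matter. It is smooth when its pullback
   by every smooth map from an open set of some R^d to P is smooth. *)
Record connection (G : set 'M[R]_m) (P : set preframe)
    (omega : preframe -> frame_tangent -> 'M[R]_m) : Prop := Connection {
  conn_lie : forall p X, P p -> tangent_P P p X -> lie_algebra G (omega p X);
  conn_linear : forall p (a : R) X Y, P p -> tangent_P P p X ->
    tangent_P P p Y -> omega p (a *: X + Y) = a *: omega p X + omega p Y;
  conn_smooth : forall (d : nat) (W : set 'cV[R]_d) (f : 'cV[R]_d -> preframe)
    (v : 'cV[R]_d), open W -> smooth_frames W f -> (forall w, W w -> P (f w)) ->
    smooth_on W (fun w => omega (f w) (pushforward f w v));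
  conn_fundamental : forall p a, P p -> curve_at1 G a ->
    omega p (pushforward (fun x => frame_act p (a x)) 0 (1 : R^o)) =
    'D_(1 : R^o) a 0;
  conn_equivariant : forall p B X, P p -> G B -> tangent_P P p X ->
    omega (frame_act p B) (frame_tangent_act X B) =
    invmx B *m omega p X *m B }.

(* The soldering form theta, in the chart [frame_chart c] *)
Definition solder_coord (z dz : 'cV[R]_m * 'M[R]_m) : 'cV[R]_m :=
  invmx z.2 *m dz.1.

Definition solder (c : atlas M) (p : preframe) (X : frame_tangent) :
  'cV[R]_m := solder_coord (frame_chart c p) (X c).

(* d theta (X, Y) = X (theta Y) - Y (theta X), where X and Y are extended as
   constant vector fields in the chart [frame_chart c] *)
Definition d_solder (c : atlas M) (p : preframe) (X Y : frame_tangent) :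
    'cV[R]_m :=
  'D_(X c) (fun z => solder_coord z (Y c)) (frame_chart c p) -
  'D_(Y c) (fun z => solder_coord z (X c)) (frame_chart c p).

(* The torsion form is Theta = d theta + omega /\ theta, and the torsion
   function T is defined by T_p (theta X, theta Y) = Theta_p (X, Y); this
   determines T_p, as theta maps the tangent space of P at p onto R^m. *)
Definition torsion_function (P : set preframe)
    (omega : preframe -> frame_tangent -> 'M[R]_m)
    (T : preframe -> 'cV[R]_m -> 'cV[R]_m -> 'cV[R]_m) : Prop :=
  forall p c X Y, P p -> dom c p.1 -> tangent_P P p X -> tangent_P P p Y ->
    T p (solder c p X) (solder c p Y) =
    d_solder c p X Y + omega p X *m solder c p Y - omega p Y *m solder c p X.

Definition D_connection (G : set 'M[R]_m) (P : set preframe)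
    (D : set ('cV[R]_m -> 'cV[R]_m -> 'cV[R]_m))
    (omega : preframe -> frame_tangent -> 'M[R]_m) : Prop :=
  connection G P omega /\
  exists2 T, torsion_function P omega T & forall p, P p -> D (T p).

Definition same_on (P : set preframe)
    (omega omega' : preframe -> frame_tangent -> 'M[R]_m) : Prop :=
  forall p X, P p -> tangent_P P p X -> omega p X = omega' p X.

End FrameBundle.

(* Main.v *)
(* GL(n, Cl(s, t)) is the group of units of the commutant of the generators
   acting on V, so its Lie algebra g is that commutant.
   If K and L are two anticommuting generators and b is in the first
   prolongation, then b(Kv, Lw) equals both KL b(v, w) and LK b(v, w), which
   are opposite; hence b = 0.

   The difference of two connections has the form delta o theta, where theta
   is the soldering form and delta : V -> g, and their torsions differ by the
   Spencer image of delta. If both torsions are in D, this image is 0, so delta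
   lies in the first prolongation and vanishes. Hence the value at a frame p
   of a D-connection is unique; since P has local sections, such a value
   exists: correct the flat connection of a section by a linear right inverse
   of the Spencer operator modulo D. By uniqueness, these values glue, are
   equivariant, and are smooth because the local formula is. *)

Require Import Defs.
From mathcomp Require Import all_boot all_order all_algebra all_field.
From mathcomp Require Import perm mxtens ring.
From mathcomp Require Import all_classical all_reals all_analysis.
Set Implicit Arguments.
Unset Strict Implicit.
Unset Printing Implicit Defensive.
Import Order.TTheory GRing.Theory Num.Theory.
Import numFieldNormedType.Exports Defs.
Local Open Scope classical_set_scope.
Local Open Scope ring_scope.

(** * Derivatives of matrix-valued functions *)

Section Calculus.
Variable R : realType.
Implicit Types E F : normedModType R.

(** Tangent vectors to [P] are velocities of curves, and these do not visibly form a vector space,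
    whereas a connection is linear on them. A local section repairs this: its flat form singles out
    the tangent vectors, among all compatible families of components, by a linear condition,
    membership in the commutant. Velocities in the group are realised by the affine curves 1 + xA,
    which remain in the commutant and are invertible near 0. The flat form of a section differs from
    the coordinate form z^-1 dz by a term in the soldering form. As z^-1 dz has no torsion, the
    torsion of the flat form is the alternation of that term, a smooth expression in the
    coordinates. The Spencer operator is inverted modulo [D] only on a fixed finite family of
    elementary alternating maps, so the correction stays smooth although the preimages are chosen
    arbitrarily. That the exterior derivative of the soldering form does not depend on the chart
    rests on the symmetry of second derivatives, whence the proof of Schwarz's theorem. *)

Lemma open_nearW (T : topologicalType) (U : set T) (x : T) (P : T -> Prop) :
  open U -> U x -> (forall y, U y -> P y) -> \forall y \near x, P y.
Proof. by move=> oU Ux UP; apply: filterS UP _; exact: open_nbhs_nbhs. Qed.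

(** The first-order expansion of [f] at [x] is also one of [g], since it only sees the germ;
    uniqueness of the differential then identifies ['d g x] with ['d f x]. *)
Lemma near_eq_differentiable E F (f g : E -> F) (x : E) :
  {near x, f =1 g} -> differentiable f x -> differentiable g x.
Proof.
move=> fg df; have fgx : f x = g x.
  exact: (@nbhs_singleton _ x (fun y => f y = g y)).
have fgs : {near (0 : E), f \o shift x =1 g \o shift x}.
  move: fg; rewrite (near_shift (0 : E) x) subr0.
  by apply: filterS => y /= ->.
have [dc dl] := (diff_locallyP _ _).1 df.
suff dg : g \o shift x = cst (g x) + 'd f x +o_ 0 id.
  by have E1 := diff_unique dc dg; apply/diff_locallyP; rewrite E1.
apply/eqaddoP => e e0; move: dl => /eqaddoP/(_ e e0).
apply: filterS2 fgs => y /= fgy; rewrite /= !fctE /= -fgx.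
by move: fgy => /= ->.
Qed.

Lemma derive_lin E F F' (L : {linear F -> F'}) (f : E -> F) x v :
  continuous L -> differentiable f x ->
  'D_v (fun y => L (f y)) x = L ('D_v f x).
Proof.
move=> cL df; rewrite !deriveE //; last first.
  apply: (@differentiable_comp _ _ _ _ f L) => //.
  exact: linear_differentiable.
rewrite [X in X v](@diff_comp _ _ _ _ f L)//; last exact: linear_differentiable.
by rewrite /= diff_lin.
Qed.

Lemma derive_comp E E' F (f : E -> E') (g : E' -> F) x v :
  differentiable f x -> differentiable g (f x) ->
  'D_v (g \o f) x = 'D_('D_v f x) g (f x).
Proof.
move=> df dg; rewrite !deriveE //; last exact: differentiable_comp.
by rewrite [X in X v]diff_comp.
Qed.

Lemma derive_pair E F F' (f : E -> F) (g : E -> F') x v :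
  differentiable f x -> differentiable g x ->
  'D_v (fun y => (f y, g y)) x = ('D_v f x, 'D_v g x).
Proof.
move=> df dg; rewrite !deriveE //; last exact: differentiable_pair.
by rewrite [X in X v]diff_pair.
Qed.

Lemma continuous_mxP E m n (f : E -> 'M[R]_(m, n)) x :
  (forall i j, {for x, continuous (fun y => f y i j : R)}) ->
  {for x, continuous f}.
Proof.
move=> fc A [P fP PA].
have : \forall y \near x, forall i j, P i j (f y i j).
  by apply: filter_forall => i; apply: filter_forall => j; exact: fc (fP i j).
by apply: filterS => y Py; exact: PA.
Qed.

Lemma differentiable_mxP E m n (f : E -> 'M[R]_(m, n)) x :
  (forall i j, differentiable (fun y => f y i j : R) x) -> differentiable f x.
Proof.
move=> df; rewrite (_ : f = \sum_(i < m) \sum_(j < n)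
    (fun y => f y i j *: delta_mx i j : 'M[R]_(m, n))); last first.
  apply/funext => y; rewrite {1}[f y]matrix_sum_delta fct_sumE.
  by apply: eq_bigr => i _; rewrite fct_sumE.
apply: differentiable_sum => i; apply: differentiable_sum => j.
exact: differentiableZl.
Qed.

Lemma differentiable_entry E m n (f : E -> 'M[R]_(m, n)) x i j :
  differentiable f x -> differentiable (fun y => f y i j : R) x.
Proof.
move=> df.
exact: (@differentiable_comp _ _ _ _ f (fun N => N i j : R) _ df
         (differentiable_coord _ _ _)).
Qed.

Lemma derive_entry E m n (f : E -> 'M[R]_(m, n)) x v i j :
  differentiable f x -> 'D_v f x i j = 'D_v (fun y => f y i j : R) x.
Proof. by move=> /diff_derivable df; rewrite derive_mx// mxE. Qed.

Lemma derive_sumE E F n (h : 'I_n -> E -> F) x v :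
  (forall i, differentiable (h i) x) ->
  'D_v (fun y => \sum_(i < n) h i y) x = \sum_(i < n) 'D_v (h i) x.
Proof.
move=> dh; rewrite -derive_sum; last by move=> i; exact: diff_derivable.
by congr ('D_v _ x); apply/funext => y; rewrite fct_sumE.
Qed.

Lemma differentiable_sumE E F n (h : 'I_n -> E -> F) x :
  (forall i, differentiable (h i) x) ->
  differentiable (fun y => \sum_(i < n) h i y) x.
Proof.
move=> /differentiable_sum; congr (differentiable _ x).
by apply/funext => y; rewrite fct_sumE.
Qed.

Lemma differentiable_mulmx E m n p (f : E -> 'M[R]_(m, n))
    (g : E -> 'M[R]_(n, p)) x :
  differentiable f x -> differentiable g x ->
  differentiable (fun y => f y *m g y) x.
Proof.
move=> df dg; apply: differentiable_mxP => i j.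
rewrite (_ : (fun y => _) = fun y => \sum_k (f y i k * g y k j)); last first.
  by apply/funext => y; rewrite mxE.
apply: differentiable_sumE => k.
by apply: differentiableM; exact: differentiable_entry.
Qed.

Lemma derive_mulmx E m n p (f : E -> 'M[R]_(m, n))
    (g : E -> 'M[R]_(n, p)) x v :
  differentiable f x -> differentiable g x ->
  'D_v (fun y => f y *m g y) x = 'D_v f x *m g x + f x *m 'D_v g x.
Proof.
move=> df dg; apply/matrixP => i j.
rewrite derive_entry; last exact: differentiable_mulmx.
rewrite (_ : (fun y => _) = fun y => \sum_k (f y i k * g y k j)); last first.
  by apply/funext => y; rewrite mxE.
rewrite derive_sumE; last first.
  by move=> k; apply: differentiableM; exact: differentiable_entry.
rewrite !mxE -big_split/=; apply: eq_bigr => k _.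
rewrite deriveM; try by apply: diff_derivable; exact: differentiable_entry.
by rewrite addrC !derive_entry//; congr (_ + _); exact: mulrC.
Qed.

Lemma derive_mulmxr E m n p (f : E -> 'M[R]_(m, n)) (B : 'M[R]_(n, p)) x v :
  differentiable f x -> 'D_v (fun y => f y *m B) x = 'D_v f x *m B.
Proof.
move=> df; rewrite (derive_mulmx v df (differentiable_cst B x)).
by rewrite (derive_cst B x v) mulmx0 addr0.
Qed.

Lemma derive_mulmxl E m n p (B : 'M[R]_(m, n)) (f : E -> 'M[R]_(n, p)) x v :
  differentiable f x -> 'D_v (fun y => B *m f y) x = B *m 'D_v f x.
Proof.
move=> df; rewrite (derive_mulmx v (differentiable_cst B x) df).
by rewrite (derive_cst B x v) mul0mx add0r.
Qed.

Lemma differentiable_det E n (f : E -> 'M[R]_n) x :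
  differentiable f x -> differentiable (fun y => \det (f y) : R) x.
Proof.
move=> df; rewrite /determinant.
have dprod (s : 'S_n) (r : seq 'I_n) :
    differentiable (fun y => \prod_(i <- r) f y i (s i)) x.
  elim: r => [|i r IH].
    rewrite (_ : (fun y => _) = cst 1); first exact: differentiable_cst.
    by apply/funext => y; rewrite big_nil.
  rewrite (_ : (fun y => _) = (fun y => f y i (s i)) *
                              (fun y => \prod_(i <- r) f y i (s i))).
    by apply: differentiableM => //; exact: differentiable_entry.
  by apply/funext => y; rewrite big_cons.
elim: (index_enum _) => [|s r IH].
  rewrite (_ : (fun y => _) = cst 0); first exact: differentiable_cst.
  by apply/funext => y; rewrite big_nil.
rewrite (_ : (fun y => _) =
  (((-1) ^+ s : R) *: (fun y => \prod_i f y i (s i) : R) : E -> R) +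
  (fun y => \sum_(s <- r) (-1) ^+ s * \prod_i f y i (s i)) :> (E -> R)).
  apply: differentiableD => //; apply: differentiableZ; exact: dprod.
by apply/funext => y; rewrite big_cons.
Qed.

Lemma continuous_det n : continuous (fun A : 'M[R]_n => \det A : R).
Proof.
move=> A; apply: differentiable_continuous; apply: differentiable_det.
by apply: differentiable_mxP => i j; exact: differentiable_coord.
Qed.

Lemma open_unitmx n : open [set A : 'M[R]_n | A \in unitmx].
Proof.
rewrite (_ : [set _ | _] = (fun A : 'M[R]_n => \det A) @^-1` [set~ 0]).
  apply: open_comp; first by move=> A _; exact: continuous_det.
  by rewrite openC; exact: closed_eq.
by apply/seteqP; split => A /=; rewrite unitmxE unitfE => /eqP.
Qed.

Lemma near_unitmx E n (f : E -> 'M[R]_n) x : {for x, continuous f} ->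
  f x \in unitmx -> \forall y \near x, f y \in unitmx.
Proof.
move=> fc fx; apply: (fc [set A | A \in unitmx]).
exact: open_nbhs_nbhs (conj (@open_unitmx n) fx).
Qed.

(** Cramer's formula. As [invmx] returns a singular matrix unchanged, the formula is only valid near
    [x], where the determinant stays nonzero. *)
Lemma differentiable_invmx E n (f : E -> 'M[R]_n) x :
  differentiable f x -> f x \in unitmx ->
  differentiable (fun y => invmx (f y)) x.
Proof.
move=> df fx.
apply: (@near_eq_differentiable _ _ (fun y => (\det (f y))^-1 *: \adj (f y))).
  have := near_unitmx (differentiable_continuous df) fx.
  by apply: filterS => y fy; rewrite /invmx fy.
apply: differentiable_mxP => i j.
rewrite (_ : (fun y => _) = (fun y => (\det (f y))^-1) *
   (((-1) ^+ (j + i) : R) *: (fun y => \det (row' j (col' i (f y))) : R))).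
  apply: differentiableM.
    apply: differentiableV; first exact: differentiable_det.
    by rewrite -unitfE -unitmxE.
  apply: differentiableZ; apply: differentiable_det.
  apply: differentiable_mxP => k l.
  rewrite (_ : (fun y => _) = fun y => f y (lift j k) (lift i l)).
    exact: differentiable_entry.
  by apply/funext => y; rewrite !mxE.
by apply/funext => y; rewrite !mxE.
Qed.

(** Differentiate the product of [f] and its inverse, which is constant near [x]. *)
Lemma derive_invmx E n (f : E -> 'M[R]_n) x v :
  differentiable f x -> f x \in unitmx ->
  'D_v (fun y => invmx (f y)) x = - (invmx (f x) *m 'D_v f x *m invmx (f x)).
Proof.
move=> df fx; have di := differentiable_invmx df fx.
have := derive_mulmx v df di.
rewrite (@near_eq_derive _ _ _ _ (cst 1%:M)); last first.
  have := near_unitmx (differentiable_continuous df) fx.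
  by apply: filterS => y fy; rewrite mulmxV.
rewrite derive_cst => /esym/eqP; rewrite addrC addr_eq0 => /eqP.
move=> /(congr1 (mulmx (invmx (f x)))); rewrite mulKmx// => ->.
by rewrite mulmxN mulmxA.
Qed.

Lemma invmxM n (A B : 'M[R]_n) : A \in unitmx -> B \in unitmx ->
  invmx (A *m B) = invmx B *m invmx A.
Proof.
move=> uA uB; have uAB : A *m B \in unitmx by rewrite unitmx_mul uA.
apply: (can_inj (mulKmx uAB)); rewrite mulmxV// mulmxA -(mulmxA A).
by rewrite mulmxV// mulmx1 mulmxV.
Qed.

End Calculus.

(** * Closure properties of C^k functions *)

Section Smooth.
Variable R : realType.
Implicit Types E F : normedModType R.

Lemma Ck_onW E F k (U : set E) (f : E -> F) : Ck_on k.+1 U f -> Ck_on k U f.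
Proof.
elim: k f => [|k IH] f [df Df].
  by move=> x /df /differentiable_continuous.
by split=> // v; exact: IH.
Qed.

Lemma Ck_onS E F k (U V : set E) (f : E -> F) :
  U `<=` V -> Ck_on k V f -> Ck_on k U f.
Proof.
move=> UV; elim: k f => [|k IH] f /=; first by move=> fc x /UV /fc.
by case=> df Df; split=> [x /UV /df //|v]; exact: IH.
Qed.

Lemma Ck_on_eq E F k (U : set E) (f g : E -> F) : open U ->
  (forall x, U x -> f x = g x) -> Ck_on k U f -> Ck_on k U g.
Proof.
move=> oU; elim: k f g => [|k IH] f g fg /=.
  move=> fc x Ux; have fgx : {near x, f =1 g} by exact: open_nearW fg.
  rewrite /prop_for /continuous_at -(fg _ Ux).
  by apply: cvg_trans (fc _ Ux); exact: near_eq_cvg.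
case=> df Df; split=> [x Ux|v].
  by apply: near_eq_differentiable (df x Ux); exact: open_nearW fg.
apply: IH (Df v) => x Ux; apply: near_eq_derive.
exact: open_nearW fg.
Qed.

(** [Ck_on] is a conjunction of conditions at the single points of [U] on the globally defined
    functions ['D_v f], so it can be checked on a cover. *)
Lemma Ck_on_local E F k (U : set E) (f : E -> F) :
  (forall x, U x -> exists2 V, V x & Ck_on k V f) -> Ck_on k U f.
Proof.
elim: k f => [|k IH] f Uf /=; first by move=> x /Uf [V Vx]; exact.
split=> [x /Uf[V Vx [+ _]]|v]; first exact.
by apply: IH => x /Uf [V Vx [_ DV]]; exists V => //; exact: DV.
Qed.

Lemma Ck_cst E F k (U : set E) (a : F) : Ck_on k U (cst a : E -> F).
Proof.
elim: k a => [|k IH] a /=; first by move=> x _; exact: cst_continuous.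
split=> [x _|v]; first exact: differentiable_cst.
rewrite (_ : 'D_v _ = cst 0); first exact: IH.
by apply/funext => x; exact: derive_cst.
Qed.

Lemma Ck_lin E F F' (L : {linear F -> F'}) k (U : set E) (f : E -> F) :
  open U -> continuous L -> Ck_on k U f -> Ck_on k U (fun x => L (f x)).
Proof.
move=> oU cL; elim: k f => [|k IH] f /=.
  by move=> fc x Ux; apply: continuous_comp; [exact: fc|exact: cL].
case=> df Df; split=> [x Ux|v].
  apply: (@differentiable_comp _ _ _ _ f L); first exact: df.
  exact: linear_differentiable.
by apply: Ck_on_eq oU _ (IH _ (Df v)) => x Ux; rewrite derive_lin//; exact: df.
Qed.

Lemma Ck_add E F k (U : set E) (f g : E -> F) : open U ->
  Ck_on k U f -> Ck_on k U g -> Ck_on k U (fun x => f x + g x).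
Proof.
move=> oU; elim: k f g => [|k IH] f g /=.
  by move=> fc gc x Ux; apply: continuousD; [exact: fc|exact: gc].
case=> df Df [dg Dg]; split=> [x Ux|v].
  by apply: differentiableD; [exact: df|exact: dg].
apply: Ck_on_eq oU _ (IH _ _ (Df v) (Dg v)) => x Ux.
by rewrite deriveD//; apply: diff_derivable; [exact: df|exact: dg].
Qed.

Lemma Ck_sum E F k (U : set E) (I : Type) (r : seq I) (f : I -> E -> F) :
  open U -> (forall i, Ck_on k U (f i)) ->
  Ck_on k U (fun x => \sum_(i <- r) f i x).
Proof.
move=> oU fi; elim: r => [|i r IH].
  rewrite (_ : (fun x => _) = cst 0); first exact: Ck_cst.
  by apply/funext => x; rewrite big_nil.
rewrite (_ : (fun x => _) = fun x => f i x + \sum_(i <- r) f i x).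
  exact: Ck_add.
by apply/funext => x; rewrite big_cons.
Qed.

(** The Leibniz rule brings back [f] and [g] themselves beside their derivatives; [Ck_onW] lowers
    them to the order of the induction hypothesis. *)
Lemma Ck_mul E k (U : set E) (f g : E -> R) : open U ->
  Ck_on k U f -> Ck_on k U g -> Ck_on k U (fun x => f x * g x).
Proof.
move=> oU; elim: k f g => [|k IH] f g fk gk.
  by move=> x Ux; apply: continuousM; [exact: fk|exact: gk].
have [[df Df] [dg Dg]] := (fk, gk); split=> [x Ux|v].
  by apply: differentiableM; [exact: df|exact: dg].
apply: (Ck_on_eq (f := fun x => f x * 'D_v g x + g x * 'D_v f x) oU).
  move=> x Ux.
  by rewrite deriveM//; apply: diff_derivable; [exact: df|exact: dg].
have fDg := IH f ('D_v g) (Ck_onW fk) (Dg v).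
have gDf := IH g ('D_v f) (Ck_onW gk) (Df v).
exact: (Ck_add oU fDg gDf).
Qed.

Lemma Ck_scale E F k (U : set E) (f : E -> F) (a : R) : open U ->
  Ck_on k U f -> Ck_on k U (fun x => a *: f x).
Proof.
by move=> oU; apply: (@Ck_lin _ _ _ ( *:%R a)) => //; exact: scaler_continuous.
Qed.

Lemma Ck_opp E F k (U : set E) (f : E -> F) : open U ->
  Ck_on k U f -> Ck_on k U (fun x => - f x).
Proof.
move=> oU fk; apply: (Ck_on_eq (f := fun x => -1 *: f x) oU).
  by move=> x _; rewrite scaleN1r.
exact: Ck_scale.
Qed.

Lemma Ck_pair E F F' k (U : set E) (f : E -> F) (g : E -> F') : open U ->
  Ck_on k U f -> Ck_on k U g -> Ck_on k U (fun x => (f x, g x)).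
Proof.
move=> oU; elim: k f g => [|k IH] f g /=.
  by move=> fc gc x Ux; apply: cvg_pair; [exact: fc|exact: gc].
case=> df Df [dg Dg]; split=> [x Ux|v].
  by apply: differentiable_pair; [exact: df|exact: dg].
apply: Ck_on_eq oU _ (IH _ _ (Df v) (Dg v)) => x Ux.
by rewrite derive_pair//; [exact: df|exact: dg].
Qed.

Lemma Ck_fst E F F' k (U : set E) (f : E -> F * F') : open U ->
  Ck_on k U f -> Ck_on k U (fun x => (f x).1).
Proof.
move=> oU; apply: (@Ck_lin _ _ _ fst) => //.
by move=> x; exact: cvg_fst.
Qed.

Lemma Ck_snd E F F' k (U : set E) (f : E -> F * F') : open U ->
  Ck_on k U f -> Ck_on k U (fun x => (f x).2).
Proof.
move=> oU; apply: (@Ck_lin _ _ _ snd) => //.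
by move=> x; exact: cvg_snd.
Qed.

Lemma Ck_entry E k m n (U : set E) (f : E -> 'M[R]_(m, n)) i j : open U ->
  Ck_on k U f -> Ck_on k U (fun x => f x i j : R).
Proof.
move=> oU; elim: k f => [|k IH] f /=.
  move=> fc x Ux.
  apply: (@continuous_comp _ _ _ f (fun N : 'M[R]_(m, n) => N i j)).
    exact: fc.
  exact: coord_continuous.
case=> df Df; split=> [x Ux|v]; first by apply/differentiable_entry/df.
apply: Ck_on_eq oU _ (IH _ (Df v)) => x Ux.
by rewrite derive_entry//; exact: df.
Qed.

Lemma Ck_mx E k m n (U : set E) (f : E -> 'M[R]_(m, n)) : open U ->
  (forall i j, Ck_on k U (fun x => f x i j : R)) -> Ck_on k U f.
Proof.
move=> oU; elim: k f => [|k IH] f fij.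
  by move=> x Ux; apply: continuous_mxP => i j; exact: fij.
have df x : U x -> differentiable f x.
  by move=> Ux; apply: differentiable_mxP => i j; have [+ _] := fij i j; exact.
split=> // v; apply: IH => i j; have [_ /(_ v)] := fij i j.
by apply: Ck_on_eq => // x Ux; rewrite derive_entry//; exact: df.
Qed.

Lemma Ck_mulmx E k m n p (U : set E) (f : E -> 'M[R]_(m, n))
    (g : E -> 'M[R]_(n, p)) : open U ->
  Ck_on k U f -> Ck_on k U g -> Ck_on k U (fun x => f x *m g x).
Proof.
move=> oU fk gk; apply: Ck_mx => // i j.
rewrite (_ : (fun x => _) = fun x => \sum_l (f x i l * g x l j)).
  by apply: Ck_sum => // l; apply: Ck_mul => //; exact: Ck_entry.
by apply/funext => x; rewrite mxE.
Qed.

(** In the derivative - f^-1 f' f^-1 the inverse occurs undifferentiated, so its regularity improves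
    by one order at each step of the induction. *)
Lemma Ck_invmx E k n (U : set E) (f : E -> 'M[R]_n) : open U ->
  (forall x, U x -> f x \in unitmx) ->
  Ck_on k U f -> Ck_on k U (fun x => invmx (f x)).
Proof.
move=> oU fu; elim: k => [|k IH] fk.
  move=> x Ux; apply: (@continuous_comp _ _ _ f (@invmx R n)); first exact: fk.
  apply: differentiable_continuous.
  by apply: (@differentiable_invmx _ _ _ id); [exact: ex_diff|exact: fu].
have [df Df] := fk; split=> [x Ux|v].
  by apply: differentiable_invmx; [exact: df|exact: fu].
have fk' := IH (Ck_onW fk).
apply: (Ck_on_eq (f := fun x => -1 *:
   (invmx (f x) *m 'D_v f x *m invmx (f x))) oU).
  by move=> x Ux; rewrite derive_invmx ?scaleN1r//; [exact: df|exact: fu].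
apply: Ck_scale => //; apply: Ck_mulmx => //.
by apply: Ck_mulmx (Df v).
Qed.

(** The chain rule differentiates [g] in a direction that varies with the point, while [Ck_on]
    controls fixed directions only; hence the expansion on the standard basis, and the coordinate
    space as domain of [g]. *)
Lemma Ck_comp_scalar E k m (U : set E) (V : set 'cV[R]_m) (f : E -> 'cV[R]_m)
    (g : 'cV[R]_m -> R) : open U -> (forall x, U x -> V (f x)) ->
  Ck_on k U f -> Ck_on k V g -> Ck_on k U (g \o f).
Proof.
move=> oU UV; elim: k g => [|k IH] g fk gk.
  by move=> x Ux; apply: continuous_comp; [exact: fk|apply: gk; exact: UV].
have [[df Df] [dg Dg]] := (fk, gk); split=> [x Ux|v].
  by apply: differentiable_comp; [exact: df|apply: dg; exact: UV].
apply: (Ck_on_eq (f := fun x => \sum_(i < m)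
    'D_v f x i 0 * 'D_(delta_mx i 0) g (f x)) oU).
  move=> x Ux; rewrite (derive_comp v (df x Ux) (dg _ (UV _ Ux))).
  have dgx := dg _ (UV _ Ux).
  rewrite [RHS]deriveE // [X in _ = _ X](matrix_sum_delta ('D_v f x)).
  rewrite linear_sum/=; apply: eq_bigr => i _.
  by rewrite big_ord1 linearZ/= (deriveE _ dgx).
apply: Ck_sum => // i; apply: Ck_mul => //; first exact: Ck_entry (Df v).
exact: IH (Ck_onW fk) (Dg _).
Qed.

Lemma Ck_comp E k m n p (U : set E) (V : set 'cV[R]_m) (f : E -> 'cV[R]_m)
    (g : 'cV[R]_m -> 'M[R]_(n, p)) :
  open U -> open V -> (forall x, U x -> V (f x)) ->
  Ck_on k U f -> Ck_on k V g -> Ck_on k U (g \o f).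
Proof.
move=> oU oV UV fk gk; apply: Ck_mx => // i j.
apply: (@Ck_comp_scalar _ _ _ _ _ f (fun z => g z i j) oU UV fk).
exact: Ck_entry.
Qed.

Lemma Ck_id (E : normedModType R) k (U : set E) : Ck_on k U (id : E -> E).
Proof.
case: k => [|k]; first by move=> x _; exact: cvg_id.
split=> [x _|v]; first exact: ex_diff.
rewrite (_ : 'D_v _ = cst v); first exact: Ck_cst.
by apply/funext => x; exact: derive_id.
Qed.

Lemma Ck_scalemx (E : normedModType R) k n p (U : set E) (f : E -> R)
    (g : E -> 'M[R]_(n, p)) : open U ->
  Ck_on k U f -> Ck_on k U g -> Ck_on k U (fun x => f x *: g x).
Proof.
move=> oU fk gk; apply: Ck_mx => // i j.
rewrite (_ : (fun x => _) = fun x => f x * g x i j).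
  by apply: Ck_mul => //; exact: Ck_entry.
by apply/funext => x; rewrite mxE.
Qed.

End Smooth.

(** * Symmetry of second derivatives *)

Section Schwarz.
Variable R : realType.
Implicit Types E F : normedModType R.

Lemma is_diff_line E (p w : E) (t : R) :
  is_diff t (fun t : R => p + t *: w) (fun t => t *: w).
Proof.
have := @is_diffD _ _ _ (cst p) (fun t : R => t *: w) 0 (fun t : R => t *: w) t
  (is_diff_cst p t) (is_diff_scalel t w).
by rewrite add0r.
Qed.

Lemma Ck_line k n p (U : set R^o) (a b : 'M[R]_(n, p)) : open U ->
  Ck_on k U (fun x : R^o => a + x *: b).
Proof.
move=> oU; apply: Ck_mx => // i j.
rewrite (_ : (fun x => _) = fun x : R^o => a i j + x * b i j).
  apply: Ck_add => //; first exact: (@Ck_cst _ _ _ _ _ (a i j)).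
  apply: Ck_mul => //; first exact: (@Ck_id R^o).
  exact: (@Ck_cst _ _ _ _ _ (b i j)).
by apply/funext => x; rewrite !mxE.
Qed.

Lemma differentiable_line (E : normedModType R) (a b : E) (t : R^o) :
  differentiable (fun x : R^o => a + x *: b) t.
Proof. by case: (is_diff_line a b t). Qed.

Lemma derive_line (E : normedModType R) (a b : E) (t : R^o) :
  'D_(1 : R^o) (fun x : R^o => a + x *: b) t = b.
Proof.
have [dl dlE] := is_diff_line a b t.
by rewrite (deriveE _ dl) dlE scale1r.
Qed.

Lemma is_derive_line E F (g : E -> F) (p w : E) (t : R) :
  differentiable g (p + t *: w) ->
  is_derive t 1 (fun t : R => g (p + t *: w)) ('D_w g (p + t *: w)).
Proof.
move=> dg; have dl := is_diff_line p w t.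
have dt : differentiable (fun t : R => p + t *: w) t by [].
have dc := @differentiable_comp _ _ _ _ (fun t : R => p + t *: w) g t dt dg.
apply: DeriveDef; first exact: diff_derivable dc.
rewrite [LHS](@derive_comp _ _ _ _ (fun t : R => p + t *: w) g t 1 dt dg).
by congr ('D__ g _); rewrite deriveE // diff_val scale1r.
Qed.

Lemma MVT_line E (f : E -> R) (p w : E) (h : R) : 0 <= h ->
  (forall t : R, 0 <= t <= h -> differentiable f (p + t *: w)) ->
  exists2 t, 0 <= t <= h & f (p + h *: w) - f p = h * 'D_w f (p + t *: w).
Proof.
move=> h0 df.
pose g (t : R) : R := f (p + t *: w).
have dl t : t \in `[0, h]%R -> is_derive t 1 g ('D_w f (p + t *: w)).
  by rewrite in_itv/= => th; apply: is_derive_line; exact: df.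
have dl_oo t : t \in `]0, h[%R -> is_derive t 1 g ('D_w f (p + t *: w)).
  by move=> /subset_itv_oo_cc; exact: dl.
have cg : {within `[0, h], continuous g}.
  by apply: derivable_within_continuous => t /dl [].
have [t th gh] := MVT_segment h0 dl_oo cg.
exists t; first by move: th; rewrite in_itv.
by move: gh; rewrite /g scale0r addr0 subr0 mulrC.
Qed.

Lemma subr_exchange (V : zmodType) (a b c d : V) :
  a - b - (c - d) = a - c - (b - d).
Proof.
by rewrite !opprB !addrA [LHS]addrAC [RHS]addrAC; congr (_ + _); exact: addrAC.
Qed.

(** Two mean value theorems: one in direction [u] for the increment y |-> f (y + hv) - f y, then one
    in direction [v] for ['D_u f]. *)
Lemma mixed_difference E (U : set E) (f : E -> R) (x u v : E) (h : R) :
  0 <= h ->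
  (forall s t : R, 0 <= s <= h -> 0 <= t <= h -> U (x + s *: u + t *: v)) ->
  Ck_on 2 U f ->
  exists s t, [/\ 0 <= s <= h, 0 <= t <= h &
    f (x + h *: u + h *: v) - f (x + h *: v) - (f (x + h *: u) - f x) =
    h * (h * 'D_v ('D_u f) (x + s *: u + t *: v))].
Proof.
move=> h0 Uxuv [df /(_ u) [dDf _]].
have h00 : 0 <= (0 : R) <= h by rewrite lexx h0.
have hhh : 0 <= h <= h by rewrite lexx h0.
have dfv s : 0 <= s <= h -> differentiable f (x + h *: v + s *: u).
  by move=> sh; rewrite addrAC; apply: df; exact: Uxuv.
have df0 s : 0 <= s <= h -> differentiable f (x + s *: u).
  by move=> sh; rewrite -[_ + _]addr0 -(scale0r v); apply: df; exact: Uxuv.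
pose g y := f (h *: v + y) - f y.
have dsh y : differentiable f (h *: v + y) -> 
    is_diff y (fun y => f (h *: v + y)) ('d f (h *: v + y)).
  move=> dfy.
  have dT : is_diff y (fun y : E => h *: v + y) id.
    have := @is_diffD _ _ _ (cst (h *: v)) id 0 id y (is_diff_cst _ y)
      (is_diff_id y).
    by rewrite add0r.
  have := @is_diff_comp _ _ _ _ _ _ f _ y dT (differentiableP dfy).
  by [].
have dg s : 0 <= s <= h -> is_diff (x + s *: u) g
    (('d f (h *: v + (x + s *: u)) : E -> R) - ('d f (x + s *: u) : E -> R)).
  move=> sh; apply: is_diffB.
    by apply: dsh; rewrite addrC addrAC; exact: dfv.
  exact: differentiableP (df0 s sh).
have [s sh Eg] : exists2 s, 0 <= s <= h &
    g (x + h *: u) - g x = h * 'D_u g (x + s *: u).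
  by apply: (@MVT_line E g x u h h0) => s /dg [].
have [t th Et] : exists2 t, 0 <= t <= h &
    'D_u f (x + s *: u + h *: v) - 'D_u f (x + s *: u) =
    h * 'D_v ('D_u f) (x + s *: u + t *: v).
  by apply: (@MVT_line E ('D_u f) (x + s *: u) v h h0) => t th; exact/dDf/Uxuv.
exists s, t; split=> //; rewrite -Et.
rewrite (_ : 'D_u f _ - 'D_u f _ = 'D_u g (x + s *: u)).
  by rewrite -Eg /g ![h *: v + _]addrC; exact: subr_exchange.
have [dgs dgE] := dg s sh.
rewrite (deriveE _ dgs) dgE !deriveE ?(addrC (h *: v)) //.
  exact: df0.
by rewrite addrAC; exact: dfv.
Qed.

Lemma dist_le_halves (a b c e : R) :
  `|a - c| < e / 2 -> `|b - c| < e / 2 -> `|a - b| <= e.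
Proof.
move=> ac bc; apply: le_trans (ler_distD c a b) _.
by rewrite (splitr e) lerD// ltW// distrC.
Qed.

(** The second difference over a small parallelogram is symmetric in [u] and [v], so the two mixed
    derivatives take a common value at two points close to [x]; continuity brings both points back
    to [x]. *)
Lemma derive_swap_scalar E (U : set E) (f : E -> R) (x u v : E) : open U ->
  U x -> Ck_on 2 U f -> 'D_u ('D_v f) x = 'D_v ('D_u f) x.
Proof.
move=> oU Ux fC2.
have cont a b : {for x, continuous ('D_a ('D_b f))}.
  have [_ /(_ b) [_ /(_ a)]] := fC2; exact.
apply/eqP; rewrite -subr_eq0 -normr_le0; apply/ler_addgt0Pl => e e0.
rewrite addr0.
have e2 : 0 < e / 2 by rewrite divr_gt0.
have [d d0 dU] : exists2 d : R, 0 < d & forall y, `|y| < d ->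
  [/\ U (x + y), `|'D_u ('D_v f) x - 'D_u ('D_v f) (x + y)| < e / 2 &
      `|'D_v ('D_u f) x - 'D_v ('D_u f) (x + y)| < e / 2].
  have /nbhs_ballP[d d0 dP] : \forall y \near x, [/\ U y,
     `|'D_u ('D_v f) x - 'D_u ('D_v f) y| < e / 2 &
      `|'D_v ('D_u f) x - 'D_v ('D_u f) y| < e / 2].
    have near_cont a b :
        \forall y \near x, `|'D_a ('D_b f) x - 'D_a ('D_b f) y| < e / 2.
      by move: (cont a b) => /cvgrPdist_lt/(_ _ e2).
    have nU : \forall y \near x, U y by exact: open_nbhs_nbhs.
    by apply: filterS3 nU (near_cont u v) (near_cont v u) => y.
  exists d => // y yd; apply: dP.
  by rewrite -ball_normE /= opprD addrA subrr sub0r normrN.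
(* With this side length the parallelogram spanned by hu and hv lies in the ball of radius [d]; the
   summand 1 keeps the denominator positive and the bound strict. *)
pose h := d / (`|u| + `|v| + 1).
have c0 : 0 < `|u| + `|v| + 1 by rewrite ltr_wpDl// addr_ge0.
have h0 : 0 < h by rewrite divr_gt0.
have small s t : 0 <= s <= h -> 0 <= t <= h -> `|s *: u + t *: v| < d.
  move=> /andP[s0 sh] /andP[t0 th].
  rewrite (le_lt_trans (ler_normD _ _))// !normrZ !ger0_norm//.
  rewrite (@le_lt_trans _ _ (h * (`|u| + `|v|)))//.
    by rewrite mulrDr lerD// ler_wpM2r.
  by rewrite /h mulrAC ltr_pdivrMr// ltr_pM2l// ltrDl.
have [|s [t [sh th E1]]] := @mixed_difference E U f x u v h (ltW h0) _ fC2.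
  by move=> s t sh th; rewrite -addrA; have [] := dU _ (small s t sh th).
have [|t' [s' [th' sh' E2]]] := @mixed_difference E U f x v u h (ltW h0) _ fC2.
  move=> s' t' sh' th'; rewrite -addrA (addrC (s' *: v)).
  by have [] := dU _ (small t' s' th' sh').
have E3 : 'D_v ('D_u f) (x + s *: u + t *: v) =
          'D_u ('D_v f) (x + t' *: v + s' *: u).
  apply: (mulfI (lt0r_neq0 h0)); apply: (mulfI (lt0r_neq0 h0)).
  apply: etrans (esym E1) (etrans _ E2).
  have -> : x + h *: v + h *: u = x + h *: u + h *: v by exact: addrAC.
  exact: subr_exchange.
have [_ _ B1] := dU _ (small s t sh th).
have [_ B2 _] := dU _ (small s' t' sh' th').
rewrite addrA E3 in B1; rewrite addrA (addrAC x) in B2.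
exact: dist_le_halves B2 B1.
Qed.

Lemma derive_swap E m n (U : set E) (f : E -> 'M[R]_(m, n)) (x u v : E) :
  open U -> U x -> Ck_on 2 U f -> 'D_u ('D_v f) x = 'D_v ('D_u f) x.
Proof.
move=> oU Ux fC2; apply/matrixP => i j.
have [df Df] := fC2.
have DD a b : 'D_a ('D_b f) x i j = 'D_a ('D_b (fun y => f y i j : R)) x.
  have [dDf _] := Df b; rewrite derive_entry; last exact: dDf.
  apply: near_eq_derive; apply: open_nearW oU Ux _ => y Uy.
  by rewrite derive_entry//; exact: df.
have fij := Ck_entry i j oU fC2.
apply: etrans (DD u v) (etrans _ (esym (DD v u))).
exact: (derive_swap_scalar u v oU Ux fij).
Qed.

End Schwarz.

(** * Commutants and the Clifford group *)

Section Commutant.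
Variables (R : realType) (m : nat).
Implicit Types (S : set 'M[R]_m) (X Y B : 'M[R]_m).

(** The geometric part is carried out for the group of units of any commutant. Such a commutant is
    an associative algebra that is also the Lie algebra of its units, so products, inverses and
    conjugates of group and Lie algebra elements can be mixed freely. *)
Definition commutant S : set 'M[R]_m :=
  [set X | forall K, S K -> X *m K = K *m X].

Definition commutant_group S : set 'M[R]_m :=
  [set B | B \in unitmx /\ commutant S B].

Lemma commutantP S a X Y :
  commutant S X -> commutant S Y -> commutant S (a *: X + Y).
Proof.
by move=> cX cY K SK; rewrite mulmxDl mulmxDr -scalemxAl -scalemxAr cX// cY.
Qed.

Lemma commutant0 S : commutant S 0.
Proof. by move=> K _; rewrite mul0mx mulmx0. Qed.

Lemma commutantZ S a X : commutant S X -> commutant S (a *: X).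
Proof.
by move=> cX; rewrite -[_ *: _]addr0; exact: commutantP cX (@commutant0 S).
Qed.

Lemma commutantD S X Y : commutant S X -> commutant S Y -> commutant S (X + Y).
Proof. by move=> cX; rewrite -[X in X + Y]scale1r; exact: commutantP. Qed.

Lemma commutantN S X : commutant S X -> commutant S (- X).
Proof. by rewrite -scaleN1r; exact: commutantZ. Qed.

Lemma commutant_sum S (I : Type) (r : seq I) (X : I -> 'M[R]_m) :
  (forall i, commutant S (X i)) -> commutant S (\sum_(i <- r) X i).
Proof.
move=> cX; elim/big_ind: _ => //; first exact: commutant0.
by move=> ? ?; exact: commutantD.
Qed.

Lemma commutant1 S : commutant S 1%:M.
Proof. by move=> K _; rewrite mul1mx mulmx1. Qed.

Lemma commutantM S X Y :
  commutant S X -> commutant S Y -> commutant S (X *m Y).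
Proof. by move=> cX cY K SK; rewrite -mulmxA cY// mulmxA cX// mulmxA. Qed.

Lemma commutantV S X : commutant S X -> commutant S (invmx X).
Proof.
move=> cX K SK; have [uX|nuX] := boolP (X \in unitmx); last first.
  (* [invmx] is the identity on singular matrices. *)
  by rewrite /invmx (negbTE nuX) cX.
by rewrite -{1}[K](mulmxK uX) -cX// !mulmxA mulVmx// mul1mx.
Qed.

Lemma commutant_derive S (E : normedModType R) (f : E -> 'M[R]_m) x v :
  differentiable f x -> (\forall y \near x, commutant S (f y)) ->
  commutant S ('D_v f x).
Proof.
move=> df cf K SK; rewrite -derive_mulmxr// -derive_mulmxl//.
by apply: near_eq_derive; apply: filterS cf => y; exact.
Qed.

Lemma near_unitmx_line X : \forall x \near (0 : R^o), 1%:M + x *: X \in unitmx.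
Proof.
apply: near_unitmx; first exact/differentiable_continuous/differentiable_line.
by rewrite scale0r addr0 unitmx1.
Qed.

(** Commutation with [S] is linear, hence passes to derivatives of curves. Conversely [X] is the
    velocity of 1 + xX, whose domain is restricted to the interior of the set where it is
    invertible. *)
Lemma lie_algebra_commutant S : lie_algebra (commutant_group S) = commutant S.
Proof.
apply/seteqP; split=> [_ [a [a0 [W [oW W0 aW Ga]]] <-]|X cX].
  have [da _] := aW 1%N.
  apply: commutant_derive; first exact: da.
  by apply: open_nearW oW W0 _ => x /Ga [].
exists (fun x : R^o => 1%:M + x *: X); last exact: derive_line.
split; first by rewrite scale0r addr0.
set U := [set x : R^o | 1%:M + x *: X \in unitmx].
exists U°; split.
- exact: open_interior.
- exact: near_unitmx_line.
- by move=> k; apply: Ck_line; exact: open_interior.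
- move=> x /interior_subset ux; split=> //; rewrite addrC.
  by apply: commutantP => //; exact: commutant1.
Qed.

Lemma commutant_group_type1 S (K L : 'M[R]_m) : (0 < m)%N ->
  S K -> S L -> K \in unitmx -> L \in unitmx -> K *m L = - (L *m K) ->
  of_type1 (commutant_group S).
Proof.
move=> m0 SK SL uK uL KL; rewrite /of_type1 lie_algebra_commutant.
split; last first.
  (* The identity lies in the Lie algebra, and it is nonzero because the dimension is positive. *)
  move=> cS; have : commutant S 1%:M by exact: commutant1.
  rewrite cS => /matrixP/(_ (Ordinal m0) (Ordinal m0))/eqP.
  by rewrite !mxE eqxx oner_eq0.
apply/seteqP; split=> [b [_ bsym bg]|_ ->]; last first.
  split=> //; last first.
    move=> v1; exists 0; first exact: commutant0.
    by move=> v; rewrite mul0mx.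
  by split=> w a u v; rewrite scaler0 addr0.
(* With one argument fixed, [b] is an element of the commutant and so commutes with [N]; the
   symmetry of [b] carries this over to the other argument. *)
have bl N v w : S N -> b (N *m v) w = N *m b v w.
  move=> SN; have [X cX bX] := bg w.
  by rewrite !bX !mulmxA cX.
have br N v w : S N -> b v (N *m w) = N *m b v w.
  by move=> SN; rewrite bsym bl// bsym.
apply/funext => v; apply/funext => w /=.
have E1 : b (K *m v) (L *m w) = K *m (L *m b v w) by rewrite bl// br.
have E2 : b (K *m v) (L *m w) = L *m (K *m b v w) by rewrite br// bl.
have : L *m (K *m b v w) *+ 2 = 0.
  by rewrite mulr2n -{1}E2 E1 !mulmxA KL mulNmx addNr.
rewrite -scaler_nat => /eqP; rewrite scaler_eq0 pnatr_eq0/= => /eqP LK0.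
have := congr1 (fun z => invmx K *m (invmx L *m z)) LK0.
by rewrite !mulmx0 !mulKmx.
Qed.

End Commutant.

(** * The Clifford group as the unit group of a commutant *)

Section CliffordGroup.
Variables (R : realType) (s t : nat) (A : falgType R).
Variables (I : 'I_t -> A) (J : 'I_s -> A) (k : nat) (e : k.-tuple A) (n : nat).
Hypothesis be : basis_of {:A}%VS e.

Definition clifford_gens : set 'M[R]_(n * k) :=
  (range (fun i => clifford_act e n (I i))) `|`
  (range (fun j => clifford_act e n (J j))).

Lemma GL_cliffordE : GL_clifford I J e n = commutant_group clifford_gens.
Proof.
apply/seteqP; split=> B.
  by case=> uB BI BJ; split=> // K [[i _ <-]|[j _ <-]].
by case=> uB cB; split=> // [i|j]; apply: cB; [left; exists i|right; exists j].
Qed.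

Lemma lmul_mxM (a b : A) : lmul_mx e (a * b) = lmul_mx e a *m lmul_mx e b.
Proof.
apply/matrixP => i j; rewrite !mxE.
rewrite -mulrA (coord_basis be (memvf (b * e`_j))) mulr_sumr linear_sum/=.
by apply: eq_bigr => l _; rewrite -scalerAr linearZ/= !mxE mulrC.
Qed.

Lemma lmul_mx1 : lmul_mx e 1 = 1%:M.
Proof.
apply/matrixP => i j; rewrite !mxE mul1r.
by rewrite coord_free ?(basis_free be)// eq_sym.
Qed.

Lemma lmul_mxN (a : A) : lmul_mx e (- a) = - lmul_mx e a.
Proof. by apply/matrixP => i j; rewrite !mxE mulNr linearN. Qed.

Lemma clifford_actM a b :
  clifford_act e n (a * b) = clifford_act e n a *m clifford_act e n b.
Proof. by rewrite /clifford_act lmul_mxM tensmx_mul mul1mx. Qed.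

Lemma clifford_actN a : clifford_act e n (- a) = - clifford_act e n a.
Proof. by apply/matrixP => i j; rewrite /clifford_act lmul_mxN !mxE mulrN. Qed.

Lemma clifford_act1 : clifford_act e n 1 = 1%:M.
Proof.
rewrite /clifford_act lmul_mx1; apply/matrixP => i j.
case: (mxtens_indexP i) => i0 i1; case: (mxtens_indexP j) => j0 j1.
rewrite tensmxE !mxE -natrM mulnb (can_eq (@mxtens_indexK _ _)).
by rewrite xpair_eqE.
Qed.

(** Such an [a] is its own inverse up to sign, and the action is multiplicative. *)
Lemma clifford_act_unit a : a * a = 1 \/ a * a = -1 ->
  clifford_act e n a \in unitmx.
Proof.
case=> aa; have := clifford_actM a a; rewrite aa ?clifford_actN clifford_act1.
  by move=> /esym/mulmx1_unit[].
move=> /(congr1 -%R); rewrite opprK -mulmxN => /esym/mulmx1_unit[].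
by [].
Qed.

Lemma GL_clifford_type1 : (1 < s + t)%N -> (0 < n * k)%N -> is_clifford I J ->
  of_type1 (GL_clifford I J e n).
Proof.
move=> st nk0 [_ _ sqI sqJ aI aJ aIJ]; rewrite GL_cliffordE.
(* Indexing both kinds of generators by one sum type, s + t > 1 yields two distinct, hence
   anticommuting, generators whatever their kinds. *)
pose g (x : 'I_s + 'I_t) := match x with inl j => J j | inr i => I i end.
have Sg x : clifford_gens (clifford_act e n (g x)).
  by case: x => [j|i]; [right; exists j|left; exists i].
have ug x : clifford_act e n (g x) \in unitmx.
  by apply: clifford_act_unit; case: x => [j|i] /=; [left|right].
have /fintype.card_gt1P [x [y [_ _ xy]]] : (1 < #|{: 'I_s + 'I_t}|)%N.
  by rewrite card_sum !card_ord.
apply: (commutant_group_type1 nk0 (Sg x) (Sg y) (ug x) (ug y)).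
rewrite -!clifford_actM -clifford_actN; congr clifford_act.
case: x y xy => [j|i] [j'|i'] /= xy.
- by rewrite aJ//; apply: contra_neq xy => ->.
- by rewrite aIJ opprK.
- exact: aIJ.
- by rewrite aI//; apply: contra_neq xy => ->.
Qed.

End CliffordGroup.

(** * Coordinates on the frame bundle *)

Section Jacobian.
Variable R : realType.

Lemma derive_basis (F : normedModType R) m (g : 'cV[R]_m -> F) y u :
  differentiable g y ->
  'D_u g y = \sum_(l < m) u l 0 *: 'D_(delta_mx l 0) g y.
Proof.
move=> dg; rewrite deriveE// {1}(matrix_sum_delta u) linear_sum/=.
by apply: eq_bigr => l _; rewrite big_ord1 linearZ/= (deriveE _ dg).
Qed.

Lemma Ck_derive_along (E : normedModType R) k m n p (U : set E)
    (V : set 'cV[R]_m) (f u : E -> 'cV[R]_m) (g : 'cV[R]_m -> 'M[R]_(n, p)) :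
  open U -> open V -> (forall x, U x -> V (f x)) ->
  Ck_on k U f -> Ck_on k U u -> Ck_on k.+1 V g ->
  Ck_on k U (fun x => 'D_(u x) g (f x)).
Proof.
move=> oU oV UV fk uk [dg Dg].
apply: (Ck_on_eq (f := fun x => \sum_(l < m)
    u x l 0 *: 'D_(delta_mx l 0) g (f x)) oU).
  by move=> x Ux; rewrite (derive_basis _ (dg _ (UV _ Ux))).
apply: Ck_sum => // l; apply: Ck_scalemx => //; first exact: Ck_entry.
exact: (Ck_comp oU oV UV fk (Dg _)).
Qed.

Lemma derive_linear (E F : normedModType R) (g : E -> F) y a u v :
  differentiable g y -> 'D_(a *: u + v) g y = a *: 'D_u g y + 'D_v g y.
Proof. by move=> dg; rewrite !deriveE// linearP. Qed.

Variables m n : nat.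
Implicit Type phi : 'cV[R]_m -> 'cV[R]_n.

Definition jac phi (y : 'cV[R]_m) : 'M[R]_(n, m) :=
  \matrix_(i, j) 'D_(delta_mx j 0) phi y i 0.

Lemma jacE phi y u : differentiable phi y -> 'D_u phi y = jac phi y *m u.
Proof.
move=> dphi; rewrite derive_basis//; apply/matrixP => i j.
rewrite summxE !mxE; apply: eq_bigr => l _.
by rewrite !mxE !(ord1 j) mulrC.
Qed.

Lemma Ck_jac k (U : set 'cV[R]_m) phi : open U ->
  Ck_on k.+1 U phi -> Ck_on k U (jac phi).
Proof.
move=> oU [_ Dphi]; apply: Ck_mx => // i j.
rewrite (_ : (fun x => _) = fun x => 'D_(delta_mx j 0) phi x i 0).
  exact: Ck_entry (Dphi _).
by apply/funext => x; rewrite mxE.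
Qed.

Lemma derive_jac (U : set 'cV[R]_m) phi y u v : open U -> U y ->
  Ck_on 2 U phi -> 'D_u (jac phi) y *m v = 'D_u ('D_v phi) y.
Proof.
move=> oU Uy phi2; have [dphi _] := phi2.
have [dJ _] := Ck_jac oU phi2.
rewrite -(derive_mulmxr _ _ (dJ y Uy)).
apply: near_eq_derive; apply: open_nearW oU Uy _ => x Ux.
by rewrite jacE//; exact: dphi.
Qed.

(** Both sides are mixed second derivatives of [phi]. This is the form in which Schwarz's theorem
    acts on changes of charts. *)
Lemma derive_jac_sym (U : set 'cV[R]_m) phi y u v : open U -> U y ->
  Ck_on 2 U phi -> 'D_u (jac phi) y *m v = 'D_v (jac phi) y *m u.
Proof.
move=> oU Uy phi2; apply: etrans (derive_jac u v oU Uy phi2) _.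
apply: etrans (derive_swap u v oU Uy phi2) (esym _).
exact: (derive_jac v u oU Uy phi2).
Qed.

End Jacobian.

Lemma addr_sub_eq (V : zmodType) (a b x y : V) :
  a = b -> a + x - (b + y) = x - y.
Proof. by move=> ->; rewrite opprD addrACA subrr add0r. Qed.

(** * Tangent vectors of the frame bundle and the soldering form in charts *)

Section Frames.
Variables (R : realType) (m : nat) (M : smoothManifold R m).
Implicit Types (c : atlas M) (p : preframe M) (X Y : frame_tangent M).

Definition trans c c' : 'cV[R]_m -> 'cV[R]_m := chart c' \o chartV c.

Lemma open_chart c (U : set M) : open U -> open (chart c @` (U `&` dom c)).
Proof.
move=> oU; rewrite openE => _ [x [Ux cx] <-].
have n1 : \forall y \near chart c x, (chart c @` dom c) y.
  by apply: open_nbhs_nbhs; split; [exact: codom_open|exists x].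
have n2 : \forall y \near chart c x, U (chartV c y).
  apply: (@chartV_continuous _ _ M c x cx U).
  by rewrite chartK//; exact: open_nbhs_nbhs.
apply: filterS2 n1 n2 => _ [x' cx' <-] /=; rewrite chartK// => Ux'.
by exists x'.
Qed.

Definition overlap c c' : set 'cV[R]_m := chart c @` (dom c `&` dom c').

Lemma open_overlap c c' : open (overlap c c').
Proof. by rewrite /overlap setIC; apply: open_chart; exact: dom_open. Qed.

Lemma differentiable_trans c c' (x : M) : dom c x -> dom c' x ->
  differentiable (trans c c') (chart c x).
Proof.
move=> cx c'x; have [+ _] := chart_compatible c c' 1.
by apply; exists x.
Qed.

(** If the matrix in one chart kills [v], so do those in all the others: their components are images
    of this one under a linear differential, or 0 outside the domain. Injectivity of the frame then
    gives v = 0. *)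
Lemma frame_unit p c : frame_bundle p -> dom c p.1 -> p.2 c \in unitmx.
Proof.
move=> [pT pI _] cp; rewrite -unitmx_tr -row_free_unit -kermx_eq0.
apply/eqP/row_matrixP => i; rewrite row0.
have : (row i (kermx (p.2 c)^T) *m (p.2 c)^T)^T = 0.
  by rewrite -row_mul mulmx_ker row0 trmx0.
rewrite trmx_mul trmxK; set v := (row _ _)^T => pv.
suff : v = 0 by move=> /(congr1 trmx); rewrite trmxK trmx0.
apply: pI; rewrite ?in_setE//; apply/funext => c'; rewrite /frame_map mulmx0.
have [nc' /(_ c c' cp)] := pT v I.
have [c'p /(_ c'p)|/nc' //] := pselect (dom c' p.1).
by rewrite /frame_map => ->; rewrite pv linear0.
Qed.

(** The columns are components of tangent vectors, which are 0 by convention outside the chart. *)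
Lemma frame_out p c : frame_bundle p -> ~ dom c p.1 -> p.2 c = 0.
Proof.
move=> [pT _ _] ncp; apply/matrixP => i j.
have [/(_ c ncp) + _] := pT (delta_mx j 0) I.
rewrite /frame_map -colE => /matrixP/(_ i 0).
by rewrite !mxE.
Qed.

Lemma frame_trans p c c' : frame_bundle p -> dom c p.1 -> dom c' p.1 ->
  p.2 c' = jac (trans c c') (chart c p.1) *m p.2 c.
Proof.
move=> [pT _ _] cp c'p; apply/matrixP => i j.
have [_ /(_ c c' cp c'p)] := pT (delta_mx j 0) I.
rewrite /frame_map -deriveE; last exact: differentiable_trans.
rewrite jacE; last exact: differentiable_trans.
by rewrite mulmxA -!colE => /matrixP/(_ i 0); rewrite !mxE.
Qed.

Lemma near_dom (E : normedModType R) (W : set E) (f : E -> preframe M) w c :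
  open W -> W w -> smooth_frames W f -> dom c (f w).1 ->
  \forall x \near w, W x /\ dom c (f x).1.
Proof.
move=> oW Ww [_ fc _] cw.
have n1 : \forall x \near w, W x by exact: open_nbhs_nbhs.
have n2 : \forall x \near w, dom c (f x).1.
  apply: (fc w Ww (dom c)).
  by apply: open_nbhs_nbhs; split=> //; exact: dom_open.
by apply: filterS2 n1 n2.
Qed.

Lemma open_frames_dom (E : normedModType R) (W : set E)
    (f : E -> preframe M) c :
  open W -> smooth_frames W f -> open (W `&` [set w | dom c (f w).1]).
Proof. by move=> oW sf; rewrite openE => w [Ww cw]; exact: near_dom sf cw. Qed.

Lemma differentiable_frames (E : normedModType R) (W : set E)
    (f : E -> preframe M) w c :
  smooth_frames W f -> W w -> dom c (f w).1 ->
  differentiable (frame_chart c \o f) w.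
Proof. by move=> [_ _ sf] Ww cw; have [+ _] := sf c 1; exact. Qed.

Lemma pushforwardE (E : normedModType R) (g : E -> preframe M) w v c :
  dom c (g w).1 -> pushforward g w v c = 'D_v (frame_chart c \o g) w.
Proof. by move=> cw; rewrite /pushforward asboolT. Qed.

Lemma differentiable_fst (E F F' : normedModType R) (f : E -> F * F') w :
  differentiable f w -> differentiable (fun x => (f x).1) w.
Proof.
move=> df; apply: (@differentiable_comp _ _ _ _ f fst) => //.
by apply: linear_differentiable => x; exact: cvg_fst.
Qed.

Lemma differentiable_snd (E F F' : normedModType R) (f : E -> F * F') w :
  differentiable f w -> differentiable (fun x => (f x).2) w.
Proof.
move=> df; apply: (@differentiable_comp _ _ _ _ f snd) => //.
by apply: linear_differentiable => x; exact: cvg_snd.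
Qed.

Lemma derive_fst (E F F' : normedModType R) (f : E -> F * F') w v :
  differentiable f w -> ('D_v f w).1 = 'D_v (fun x => (f x).1) w.
Proof.
by move=> df; rewrite (@derive_lin _ _ _ _ fst)// => x; exact: cvg_fst.
Qed.

Lemma derive_snd (E F F' : normedModType R) (f : E -> F * F') w v :
  differentiable f w -> ('D_v f w).2 = 'D_v (fun x => (f x).2) w.
Proof.
by move=> df; rewrite (@derive_lin _ _ _ _ snd)// => x; exact: cvg_snd.
Qed.

(* The transformation rule of the components of the tangent vectors of the
   frame bundle, (y, z) |-> (phi y, phi'(y) z) being the change of charts. *)
Definition frame_tangent_compat p X : Prop :=
  (forall c, ~ dom c p.1 -> X c = 0) /\
  forall c c', dom c p.1 -> dom c' p.1 ->
    X c' = (jac (trans c c') (chart c p.1) *m (X c).1,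
            'D_((X c).1) (jac (trans c c')) (chart c p.1) *m p.2 c +
            jac (trans c c') (chart c p.1) *m (X c).2).

Lemma differentiable_jac_trans c c' (x : M) : dom c x -> dom c' x ->
  differentiable (jac (trans c c')) (chart c x).
Proof.
move=> cx c'x.
have [+ _] := Ck_jac (@open_overlap c c') (chart_compatible c c' 2).
by apply; exists x.
Qed.

(** Differentiate the relation of [frame_trans] along [f]: it holds at all nearby points, and the
    product rule yields the two summands of the fibre component. *)
Lemma pushforward_compat (E : normedModType R) (W : set E)
    (f : E -> preframe M) w v : open W -> W w -> smooth_frames W f ->
  frame_tangent_compat (f w) (pushforward f w v).
Proof.
move=> oW Ww sf; split=> [c nc|c c' cw c'w].
  by rewrite /pushforward asboolF.
rewrite /pushforward !asboolT//.
have df := differentiable_frames sf Ww cw.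
have df' := differentiable_frames sf Ww c'w.
have dy := differentiable_fst df; have dz := differentiable_snd df.
have dphi := differentiable_trans cw c'w.
have dJ := differentiable_jac_trans cw c'w.
have nd := near_dom oW Ww sf cw; have nd' := near_dom oW Ww sf c'w.
have -> : ('D_v (frame_chart c \o f) w).1 = 'D_v (fun x => chart c (f x).1) w.
  exact: (derive_fst v df).
have -> : ('D_v (frame_chart c \o f) w).2 = 'D_v (fun x => (f x).2 c) w.
  exact: (derive_snd v df).
apply: injective_projections => /=.
  apply: etrans (derive_fst v df') _.
  apply: etrans _ (jacE _ dphi).
  apply: etrans _ (derive_comp v dy dphi).
  apply: near_eq_derive; apply: filterS nd => x [_ cx].
  by rewrite /trans /= chartK.
apply: etrans (derive_snd v df') _.
have dJy := differentiable_comp dy dJ.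
have -> : 'D_('D_v (fun x => chart c (f x).1) w) (jac (trans c c'))
    (chart c (f w).1) = 'D_v (jac (trans c c') \o (fun x => chart c (f x).1)) w.
  exact: esym (derive_comp v dy dJ).
apply: etrans _ (derive_mulmx v dJy dz).
apply: near_eq_derive; apply: filterS2 nd nd' => x [Wx cx] [_ c'x] /=.
by apply: frame_trans => //; have [+ _ _] := sf; exact.
Qed.

Lemma compat_linear p a X Y : frame_tangent_compat p X ->
  frame_tangent_compat p Y -> frame_tangent_compat p (a *: X + Y).
Proof.
move=> [Xo Xc] [Yo Yc]; split=> [c nc|c c' cp c'p].
  by rewrite !fctE Xo// Yo// scaler0 addr0.
rewrite !fctE (Xc c c')// (Yc c c')//=.
have dJ := differentiable_jac_trans cp c'p.
rewrite derive_linear//; congr pair; rewrite /= mulmxDr -scalemxAr//.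
by rewrite mulmxDl -scalemxAl scalerDr addrACA.
Qed.

Lemma compat_inj p c X Y : dom c p.1 -> frame_tangent_compat p X ->
  frame_tangent_compat p Y -> X c = Y c -> X = Y.
Proof.
move=> cp [Xo Xc] [Yo Yc] XY; apply/funext => c'.
have [c'p|nc'] := pselect (dom c' p.1); last by rewrite Xo// Yo.
by rewrite (Xc c c')// (Yc c c')// XY.
Qed.

(** The form z^-1 dz of the connection that is flat in the coordinates of [c]. It takes values in
    all matrices and depends on the chart. *)
Definition kappa c p X : 'M[R]_m := invmx (p.2 c) *m (X c).2.

Lemma derive_solder_coord (z dz : 'cV[R]_m * 'M[R]_m) (a : 'cV[R]_m * 'M[R]_m) :
  z.2 \in unitmx ->
  'D_a (fun z => solder_coord z dz) z =
  - (invmx z.2 *m a.2 *m (invmx z.2 *m dz.1)).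
Proof.
move=> uz; have d2 : differentiable (fun z : 'cV[R]_m * 'M[R]_m => z.2) z.
  by apply: differentiable_snd; exact: ex_diff.
have di := differentiable_invmx d2 uz.
rewrite (derive_mulmxr dz.1 a di) derive_invmx// mulNmx !mulmxA.
by rewrite -(@derive_snd _ _ _ id) ?derive_id; last exact: ex_diff.
Qed.

(** The structure equation d theta = - kappa /\ theta: the coordinate connection [kappa] is
    torsion-free. *)
Lemma d_solderE c p X Y : p.2 c \in unitmx ->
  d_solder c p X Y =
  kappa c p Y *m solder c p X - kappa c p X *m solder c p Y.
Proof.
move=> up; rewrite /d_solder !derive_solder_coord//= opprK addrC.
by rewrite /kappa /solder /solder_coord/= !mulmxA.
Qed.

(** The frame matrix and the base component are both multiplied by the Jacobian, which cancels. *)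
Lemma solder_chart c c' p X : frame_bundle p -> dom c p.1 -> dom c' p.1 ->
  frame_tangent_compat p X -> solder c' p X = solder c p X.
Proof.
move=> fp cp c'p [_ Xc]; rewrite /solder /solder_coord/= (Xc c c')//=.
have uc := frame_unit fp cp; have uc' := frame_unit fp c'p.
apply: (can_inj (mulKmx uc')); rewrite mulKVmx// (frame_trans fp cp c'p).
by rewrite -[RHS]mulmxA mulKVmx.
Qed.

(* The second derivatives of the change of charts cancel by symmetry. *)
Lemma d_solder_chart c c' p X Y : frame_bundle p -> dom c p.1 -> dom c' p.1 ->
  frame_tangent_compat p X -> frame_tangent_compat p Y ->
  d_solder c' p X Y = d_solder c p X Y.
Proof.
move=> fp cp c'p cX cY.
have uc := frame_unit fp cp; have uc' := frame_unit fp c'p.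
rewrite !d_solderE// (solder_chart fp cp c'p cX) (solder_chart fp cp c'p cY).
apply: (can_inj (mulKmx uc')).
set J := jac (trans c c') (chart c p.1).
have E Z1 Z2 : frame_tangent_compat p Z1 -> frame_tangent_compat p Z2 ->
   p.2 c' *m (kappa c' p Z1 *m solder c p Z2) =
   'D_((Z1 c).1) (jac (trans c c')) (chart c p.1) *m (Z2 c).1 +
   J *m (p.2 c *m (kappa c p Z1 *m solder c p Z2)).
  move=> [_ Z1c] [_ Z2c]; rewrite /kappa /solder /solder_coord/= (Z1c c c')//=.
  rewrite !mulmxA mulmxV// mul1mx mulmxDl mulmxDl -!mulmxA mulKVmx//.
  by rewrite [p.2 c *m (invmx _ *m _)]mulKVmx.
rewrite !mulmxBr !E// (frame_trans fp cp c'p) -/J -!(mulmxA J).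
have sym : 'D_((Y c).1) (jac (trans c c')) (chart c p.1) *m (X c).1 =
          'D_((X c).1) (jac (trans c c')) (chart c p.1) *m (Y c).1.
  apply: (derive_jac_sym (Y c).1 (X c).1 (@open_overlap c c')).
    by exists p.1.
  exact: chart_compatible c c' 2.
exact: addr_sub_eq.
Qed.

End Frames.

(** * Tangent spaces of the G-structure *)

Definition local_section (R : realType) (m : nat) (M : smoothManifold R m)
    (P : set (preframe M)) (U : set M) (sigma : M -> preframe M) : Prop :=
  [/\ open U, forall x, U x -> P (sigma x) /\ (sigma x).1 = x &
      forall c, smooth_frames (chart c @` (U `&` dom c)) (sigma \o chartV c)].

Section LocalSection.
Variables (R : realType) (m : nat) (M : smoothManifold R m).
Variables (S : set 'M[R]_m) (P : set (preframe M)).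
Hypothesis GP : G_structure (commutant_group S) P.
Variables (c0 : atlas M) (U : set M) (sigma : M -> preframe M).
Hypothesis ls : local_section P U sigma.

Let oU : open U. Proof. by case: ls. Qed.
Let Psigma x : U x -> P (sigma x) /\ (sigma x).1 = x.
Proof. by case: ls => _ + _; exact. Qed.
Let ssigma c : smooth_frames (chart c @` (U `&` dom c)) (sigma \o chartV c).
Proof. by case: ls. Qed.
Let V := chart c0 @` (U `&` dom c0).

Definition section_matrix (y : 'cV[R]_m) : 'M[R]_m :=
  (sigma (chartV c0 y)).2 c0.
Local Notation Sm := section_matrix.

(* In the trivialization p = sigma * B over c0, this is B^-1 dB. *)
Definition flat_form (p : preframe M) (X : frame_tangent M) : 'M[R]_m :=
  invmx (p.2 c0) *m (X c0).2 -
  invmx (p.2 c0) *m 'D_((X c0).1) Sm (chart c0 p.1) *m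
    invmx (Sm (chart c0 p.1)) *m p.2 c0.

Lemma open_section_dom : open V.
Proof. exact: open_chart. Qed.

Lemma section_domP y : V y ->
  [/\ U (chartV c0 y), dom c0 (chartV c0 y) & chart c0 (chartV c0 y) = y].
Proof. by move=> [x [Ux cx] <-]; rewrite chartK. Qed.

Lemma section_fst y : V y -> (sigma (chartV c0 y)).1 = chartV c0 y.
Proof. by move=> /section_domP[Uy _ _]; have [] := Psigma Uy. Qed.

Lemma section_P y : V y -> P (sigma (chartV c0 y)).
Proof. by move=> /section_domP[Uy _ _]; have [] := Psigma Uy. Qed.

Lemma smooth_section_matrix : smooth_on V Sm.
Proof.
move=> k; have [_ _ /(_ c0 k)] := ssigma c0.
move=> sk.
apply: (@Ck_snd _ _ _ _ k V (frame_chart c0 \o (sigma \o chartV c0))).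
  exact: open_section_dom.
apply: Ck_onS sk => y Vy; split=> //=.
by rewrite section_fst//; have [] := section_domP Vy.
Qed.

Lemma differentiable_section_matrix y : V y -> differentiable Sm y.
Proof. by move=> Vy; have [+ _] := smooth_section_matrix 1; exact. Qed.

Lemma section_matrix_unit y : V y -> Sm y \in unitmx.
Proof.
move=> Vy; apply: frame_unit; first by apply: (gs_frames GP); exact: section_P.
by rewrite section_fst//; have [] := section_domP Vy.
Qed.

Section Tangent.
Variable p : preframe M.
Hypotheses (Pp : P p) (Up : U p.1) (cp : dom c0 p.1).

Let y := chart c0 p.1.
Let z := p.2 c0.

Lemma section_coord : V y. Proof. by exists p.1. Qed.

Lemma frame_coord_unit : z \in unitmx.
Proof. exact: frame_unit (gs_frames GP Pp) cp. Qed.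

Lemma section_frame : exists2 B, commutant_group S B &
  p = frame_act (sigma p.1) B.
Proof. by have [Ps s1] := Psigma Up; apply: (gs_trans GP). Qed.

(** This is the group element B with p = sigma B, read off in the chart [c0]. *)
Lemma section_coeff : commutant_group S (invmx (Sm y) *m z).
Proof.
have [B GB ep] := section_frame; have uS := section_matrix_unit section_coord.
rewrite /z {1}ep /= /section_matrix /y chartK//.
suff -> : invmx ((sigma p.1).2 c0) *m ((sigma p.1).2 c0 *m B) = B by [].
by rewrite mulKmx//; move: uS; rewrite /section_matrix /y chartK.
Qed.

Lemma section_coeffV : commutant S (invmx z *m Sm y).
Proof.
have [uB cB] := section_coeff; have uS := section_matrix_unit section_coord.
suff -> : invmx z *m Sm y = invmx (invmx (Sm y) *m z) by exact: commutantV.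
apply: (can_inj (mulKmx uB)); rewrite mulmxV//.
by rewrite mulmxA mulmxK ?frame_coord_unit// mulVmx.
Qed.

Lemma tangent_P_compat X : tangent_P P p X -> frame_tangent_compat p X.
Proof.
move=> [W [f [[oW W0 sf f0] _ ->]]].
by rewrite -f0; exact: pushforward_compat sf.
Qed.

Lemma near_section (W : set R^o) (f : R^o -> preframe M) : open W -> W 0 ->
  smooth_frames W f -> f 0 = p ->
  \forall x \near (0 : R^o), [/\ W x, U (f x).1 & dom c0 (f x).1].
Proof.
move=> oW W0 sf f0; have cf0 : dom c0 (f 0).1 by rewrite f0.
have n1 := near_dom oW W0 sf cf0.
have n2 : \forall x \near (0 : R^o), U (f x).1.
  have [_ /(_ 0 W0) fc _] := sf; apply: (fc U).
  by apply: open_nbhs_nbhs; split=> //=; rewrite f0.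
by apply: filterS2 n1 n2 => x [].
Qed.

(** Along a curve in [P] write f = sigma B, with B a curve in the group. The flat form of the
    velocity of f is B^-1 B', a product of two elements of the commutant. *)
Lemma tangent_P_flat_form X : tangent_P P p X -> commutant S (flat_form p X).
Proof.
move=> [W [f [[oW W0 sf f0] fP ->]]].
have cf0 : dom c0 (f 0).1 by rewrite f0.
have nW := near_section oW W0 sf f0.
have df := differentiable_frames sf W0 cf0.
pose yf (x : R^o) := chart c0 (f x).1; pose zf (x : R^o) := (f x).2 c0.
have dy : differentiable yf 0 := differentiable_fst df.
have dz : differentiable zf 0 := differentiable_snd df.
have y0 : yf 0 = y by rewrite /yf f0.
have z0 : zf 0 = z by rewrite /zf f0.
have dS : differentiable Sm (yf 0).
  by rewrite y0; exact/differentiable_section_matrix/section_coord.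
have uS : Sm (yf 0) \in unitmx.
  by rewrite y0; exact/section_matrix_unit/section_coord.
have dSy := differentiable_comp dy dS.
have dSi := differentiable_invmx dSy uS.
pose Bf x := invmx (Sm (yf x)) *m zf x.
have dB : differentiable Bf 0 := differentiable_mulmx dSi dz.
have cB : \forall x \near (0 : R^o), commutant S (Bf x).
  apply: filterS nW => x [Wx Ux cx].
  have [Ps s1] := Psigma Ux.
  have [B [_ cB] ef] := gs_trans GP Ps (fP x Wx) s1.
  rewrite /Bf /zf /yf {2}ef /= /section_matrix chartK// mulKmx//.
  by apply: frame_unit; [exact: (gs_frames GP Ps)|rewrite s1].
have cDB := commutant_derive (1 : R^o) dB cB.
suff -> : flat_form p (pushforward f 0 (1 : R^o)) =
          invmx z *m Sm y *m 'D_(1 : R^o) Bf 0.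
  by apply: commutantM => //; exact: section_coeffV.
have -> : 'D_(1 : R^o) Bf 0 =
   - (invmx (Sm y) *m 'D_('D_(1 : R^o) yf 0) Sm y *m invmx (Sm y)) *m z +
   invmx (Sm y) *m 'D_(1 : R^o) zf 0.
  apply: etrans (derive_mulmx (1 : R^o) dSi dz) _.
  rewrite -y0 -z0; congr (_ *m _ + _).
  apply: etrans (derive_invmx (1 : R^o) dSy uS) _.
  exact: (congr1 (fun d => - (invmx (Sm (yf 0)) *m d *m invmx (Sm (yf 0))))
            (derive_comp (1 : R^o) dy dS)).
have uS' : Sm y \in unitmx by rewrite -y0.
have Xc := pushforwardE (1 : R^o) cf0.
have X1 : (pushforward f 0 (1 : R^o) c0).1 = 'D_(1 : R^o) yf 0.
  by rewrite Xc; exact: (derive_fst (1 : R^o) df).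
have X2 : (pushforward f 0 (1 : R^o) c0).2 = 'D_(1 : R^o) zf 0.
  by rewrite Xc; exact: (derive_snd (1 : R^o) df).
rewrite /flat_form X1 X2 -/y -/z.
move: ('D_(1 : R^o) zf 0) ('D_('D_(1 : R^o) yf 0) Sm y) => dzf dSf.
by rewrite mulmxDr mulNmx mulmxN [RHS]addrC !mulmxA !(mulmxK uS').
Qed.

(** The vector is the velocity of x |-> sigma(y + xu) B (1 + xA), where p = sigma B. This curve
    stays in [P] as long as the line stays in the domain of the section and 1 + xA is invertible. *)
Lemma tangent_lift u A : commutant S A ->
  exists2 X, tangent_P P p X &
    X c0 = (u, 'D_u Sm y *m (invmx (Sm y) *m z) + z *m A).
Proof.
move=> cA; have [uB cB] := section_coeff; set B := invmx (Sm y) *m z in uB cB *.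
pose l (x : R^o) := y + x *: u.
pose b (x : R^o) : 'M[R]_m := B *m (1%:M + x *: A).
pose F := sigma \o chartV c0.
pose f (x : R^o) := frame_act (F (l x)) (b x).
pose W := (l @^-1` V) `&` [set x : R^o | 1%:M + x *: A \in unitmx].
have oV := open_section_dom.
have lc x : {for x, continuous l}.
  exact/differentiable_continuous/differentiable_line.
have uc x : {for x, continuous (fun x : R^o => 1%:M + x *: A)}.
  exact/differentiable_continuous/differentiable_line.
have oW : open W.
  apply: openI; first by apply: open_comp oV => x _; exact: lc.
  apply: (@open_comp _ _ (fun x : R^o => 1%:M + x *: A)
    [set A : 'M[R]_m | A \in unitmx]); first by move=> x _; exact: uc.
  exact: open_unitmx.
have l0 : l 0 = y by rewrite /l scale0r addr0.
have b0 : b 0 = B by rewrite /b scale0r addr0 mulmx1.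
have W0 : W 0.
  split; first by rewrite /= l0; exact: section_coord.
  by rewrite /= scale0r addr0 unitmx1.
have Gb x : W x -> commutant_group S (b x).
  move=> [_ ux]; split; first by rewrite unitmx_mul uB.
  apply: commutantM => //; rewrite addrC; apply: commutantP => //.
  exact: commutant1.
have Pf x : W x -> P (f x).
  by move=> Wx; apply: (gs_act GP) (Gb x Wx); apply: section_P; case: Wx.
have f0 : f 0 = p.
  rewrite /f b0 l0 /F /= /y chartK//.
  have [B' _ ep] := section_frame.
  rewrite {2}ep; congr frame_act; rewrite /B /z {1}ep /= /section_matrix /y.
  rewrite chartK// mulKmx//.
  have := section_matrix_unit section_coord.
  by rewrite /section_matrix /y chartK.
have Fdom c : open (V `&` [set w | dom c (F w).1]).
  exact: open_frames_dom oV (ssigma c0).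
have sb k (W' : set R^o) : open W' -> Ck_on k W' b.
  move=> oW'; apply: Ck_mulmx => //; first exact: (@Ck_cst _ _ _ _ _ B).
  exact: Ck_line.
have sf : smooth_frames W f.
  split=> [x Wx|x Wx|c k].
  - exact: (gs_frames GP (Pf x Wx)).
  - have [_ Fc _] := ssigma c0.
    apply: (@continuous_comp _ _ _ l (fst \o F)); first exact: lc.
    by apply: Fc; case: Wx.
  - have [_ _ /(_ c k) sF] := ssigma c0.
    set Wc := W `&` _.
    have oWc : open Wc.
      rewrite (_ : Wc = W `&` (l @^-1` (V `&` [set w | dom c (F w).1]))).
        by apply: openI => //; apply: open_comp (Fdom c) => x _; exact: lc.
      apply/seteqP; split=> x [Wx cx]; split=> //; last by case: cx.
      by split=> //; case: Wx.
    have Wcl x : Wc x -> (V `&` [set w | dom c (F w).1]) (l x).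
      by move=> [[Vx _] cx].
    have sl : Ck_on k Wc l by exact: Ck_line.
    apply: (@Ck_pair _ _ _ _ k Wc (fun x => chart c (F (l x)).1)
             (fun x => (F (l x)).2 c *m b x)) => //.
      exact: (Ck_comp oWc (Fdom c) Wcl sl (Ck_fst (Fdom c) sF)).
    apply: Ck_mulmx => //; last exact: sb.
    exact: (Ck_comp oWc (Fdom c) Wcl sl (Ck_snd (Fdom c) sF)).
exists (pushforward f 0 (1 : R^o)); first by exists W, f.
have cf0 : dom c0 (f 0).1 by rewrite f0.
rewrite (pushforwardE (1 : R^o) cf0).
have dl : differentiable l 0 := differentiable_line y u 0.
have Dl : 'D_(1 : R^o) l 0 = u := derive_line y u 0.
have dS : differentiable Sm (l 0).
  by rewrite l0; exact/differentiable_section_matrix/section_coord.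
have dSl := differentiable_comp dl dS.
have db : differentiable b 0 by have [+ _] := sb 1%N W oW; exact.
have db0 : 'D_(1 : R^o) b 0 = B *m A.
  have dA := differentiable_line 1%:M A 0.
  apply: etrans (derive_mulmxl B (1 : R^o) dA) _.
  by congr (_ *m _); exact: derive_line.
have dSl1 : 'D_(1 : R^o) (Sm \o l) 0 = 'D_u Sm y.
  apply: etrans (derive_comp (1 : R^o) dl dS) _.
  by rewrite Dl l0.
have dSb : differentiable (fun x => (Sm \o l) x *m b x) 0.
  exact: differentiable_mulmx.
have E0 : 'D_(1 : R^o) (frame_chart c0 \o f) 0 =
    'D_(1 : R^o) (fun x => (l x, (Sm \o l) x *m b x)) 0.
  apply: near_eq_derive; apply: open_nearW oW W0 _ => x [Vx _].
  rewrite /frame_chart /= section_fst//.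
  by have [_ _ ->] := section_domP Vx.
apply: etrans E0 _; apply: etrans (derive_pair (1 : R^o) dl dSb) _.
apply: injective_projections => /=; first exact: derive_line.
apply: etrans (derive_mulmx (1 : R^o) dSl db) _.
have uS := section_matrix_unit section_coord.
have zB : z = Sm y *m B by rewrite mulKVmx.
rewrite dSl1 b0 db0 /= l0 [in RHS]zB -[in RHS]mulmxA; congr (_ *m _ + _).
Qed.

(** It exhibits the set of velocities as a linear space. For the converse, lift the base component
    of [X] with [A] equal to its flat form: the lift has the same components in [c0], and one chart
    determines a compatible family. *)
Lemma tangent_PP X : tangent_P P p X <->
  frame_tangent_compat p X /\ commutant S (flat_form p X).
Proof.
split=> [tX|[cX fX]].
  by split; [exact: tangent_P_compat|exact: tangent_P_flat_form].
have [Y tY Yc] := tangent_lift (X c0).1 fX.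
suff -> : X = Y by [].
apply: (compat_inj cp cX (tangent_P_compat tY)); rewrite Yc.
apply: injective_projections => //=.
rewrite /flat_form mulmxBr mulKVmx ?frame_coord_unit//.
by rewrite -!mulmxA (mulKVmx frame_coord_unit) addrC subrK.
Qed.

Lemma flat_form_linear a X Y :
  flat_form p (a *: X + Y) = a *: flat_form p X + flat_form p Y.
Proof.
have dS := differentiable_section_matrix section_coord.
rewrite /flat_form /= (derive_linear a _ _ dS).
move: ('D__ Sm _) ('D__ Sm _) => DX DY.
rewrite !mulmxDr !mulmxDl -!scalemxAr -!scalemxAl scalerBr opprD.
by rewrite addrACA.
Qed.

(* The difference between the flat connection form and the one which is flat
   in the coordinates, as a function of the soldering form. *)
Definition section_christoffel (q : preframe M) (v : 'cV[R]_m) : 'M[R]_m :=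
  - (invmx (q.2 c0) *m 'D_(q.2 c0 *m v) Sm (chart c0 q.1) *m
     invmx (Sm (chart c0 q.1)) *m q.2 c0).

Lemma flat_formE X :
  flat_form p X = kappa c0 p X + section_christoffel p (solder c0 p X).
Proof.
rewrite /flat_form /section_christoffel /solder /solder_coord /=.
by rewrite (mulKVmx frame_coord_unit).
Qed.

Lemma section_christoffel_linear : linear (section_christoffel p).
Proof.
move=> a v w; rewrite /section_christoffel mulmxDr -scalemxAr.
have dS := differentiable_section_matrix section_coord.
rewrite (derive_linear a _ _ dS).
move: ('D__ Sm _) ('D__ Sm _) => DX DY.
by rewrite mulmxDr !mulmxDl -!scalemxAr -!scalemxAl opprD scalerN.
Qed.

End Tangent.
End LocalSection.

(** * The Spencer operator *)

Section Alternation.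
Variables (R : realType) (m : nat).
Implicit Types (S G : set 'M[R]_m) (N : 'cV[R]_m -> 'M[R]_m) 
  (b : 'cV[R]_m -> 'cV[R]_m -> 'cV[R]_m)
  (D : set ('cV[R]_m -> 'cV[R]_m -> 'cV[R]_m)).

Lemma spencer_alternating N : linear N -> alternating2 (spencer N).
Proof.
move=> lN; split; last by move=> v; rewrite /spencer subrr.
split=> [v|w] a u u'; rewrite /spencer lN mulmxDr mulmxDl -scalemxAr -scalemxAl.
  by rewrite scalerBr opprD addrACA.
by rewrite scalerBr opprD addrACA.
Qed.

Lemma linear_mx0 (X : 'M[R]_m) : (forall v : 'cV[R]_m, X *m v = 0) -> X = 0.
Proof.
move=> X0; apply/matrixP => i j; have := X0 (delta_mx j 0).
by rewrite -colE => /matrixP/(_ i 0); rewrite !mxE.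
Qed.

(** The sum with [D] is direct, so [spencer delta] is 0; and the kernel of the Spencer operator is
    the first prolongation. *)
Lemma spencer_inj S D delta :
  first_prolongation (lie_algebra (commutant_group S)) = [set 0] ->
  invariant_complement (commutant_group S) D ->
  Hom_to (lie_algebra (commutant_group S)) delta -> D (spencer delta) ->
  delta = \0.
Proof.
move=> prol0 icD [ldelta gdelta] Dd.
have spencer0 : spencer delta = 0.
  have : [set (0 : 'cV[R]_m -> 'cV[R]_m -> 'cV[R]_m)] (spencer delta).
    by rewrite -(ic_direct icD); split=> //; exists delta.
  by [].
have sym v w : delta v *m w = delta w *m v.
  apply/eqP; rewrite -subr_eq0; apply/eqP.
  exact: (congr1 (fun b => b v w) spencer0).
(* The argument held fixed in [first_prolongation] is the second one, hence the order
   [delta v1 *m v]. *)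
have : first_prolongation (lie_algebra (commutant_group S))
    (fun v v1 => delta v1 *m v).
  split=> [|v w|v1]; last by exists (delta v1) => //.
    split=> [v|w] a u u'; first by rewrite ldelta mulmxDl -scalemxAl.
    by rewrite mulmxDr -scalemxAr.
  exact: sym.
rewrite prol0 => delta0; apply/funext => v; apply: linear_mx0 => w.
exact: (congr1 (fun b => b w v) delta0).
Qed.

Lemma linear_fun0 (V W : lmodType R) (f : V -> W) : linear f -> f 0 = 0.
Proof.
move=> lf; have := lf 1 0 0; rewrite !scale1r addr0 => /esym/eqP.
by rewrite -subr_eq0 addrK => /eqP.
Qed.

Lemma linear_fun_sum (V W : lmodType R) (f : V -> W) (I : Type) (r : seq I)
    (a : I -> R) (e : I -> V) : linear f ->
  f (\sum_(i <- r) a i *: e i) = \sum_(i <- r) a i *: f (e i).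
Proof.
move=> lf; elim: r => [|i r IH]; first by rewrite !big_nil linear_fun0.
by rewrite !big_cons lf IH.
Qed.

(** Expansion on the elementary maps (v_i w_j - v_j w_i) e_a. The sum runs over all ordered pairs
    (i, j), so each unordered pair counts twice; the factor 1/2 compensates. *)
Lemma alternating_expand b : alternating2 b ->
  forall v w, b v w = 2^-1 *: \sum_(x : 'I_m * 'I_m * 'I_m)
    b (delta_mx x.1.1 0) (delta_mx x.1.2 0) x.2 0 *:
    ((v x.1.1 0 * w x.1.2 0 - v x.1.2 0 * w x.1.1 0) *: delta_mx x.2 0).
Proof.
move=> [[bl br] b0] v w.
have anti u u' : b u u' = - b u' u.
  apply/eqP; rewrite -addr_eq0; have := b0 (u + u').
  have brD : forall a a' c, b (a + a') c = b a c + b a' c.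
    by move=> a a' c; have := br c 1 a a'; rewrite !scale1r.
  have blD : forall a a' c, b c (a + a') = b c a + b c a'.
    by move=> a a' c; have := bl c 1 a a'; rewrite !scale1r.
  by rewrite brD !blD !b0 add0r addr0 => ->.
pose E i : 'cV[R]_m := delta_mx i 0.
have vE (u : 'cV[R]_m) : u = \sum_i u i 0 *: E i.
  by rewrite {1}(matrix_sum_delta u); apply: eq_bigr => i _; rewrite big_ord1.
have bE : b v w = \sum_i \sum_j (v i 0 * w j 0) *: b (E i) (E j).
  rewrite {1}(vE v) (linear_fun_sum _ _ _ (br w)); apply: eq_bigr => i _.
  rewrite {1}(vE w) (linear_fun_sum _ _ _ (bl (E i))) scaler_sumr.
  by apply: eq_bigr => j _; rewrite scalerA.
have sE : \sum_(x : 'I_m * 'I_m * 'I_m) b (E x.1.1) (E x.1.2) x.2 0 *: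
    ((v x.1.1 0 * w x.1.2 0 - v x.1.2 0 * w x.1.1 0) *: E x.2) =
    \sum_i \sum_j (v i 0 * w j 0 - v j 0 * w i 0) *: b (E i) (E j).
  rewrite pair_bigA/=.
  rewrite -(pair_bigA _ (fun (ij : 'I_m * 'I_m) a => b (E ij.1) (E ij.2) a 0 *:
    ((v ij.1 0 * w ij.2 0 - v ij.2 0 * w ij.1 0) *: E a)))/=.
  apply: eq_bigr => ij _; rewrite [in RHS](vE (b _ _)) scaler_sumr.
  by apply: eq_bigr => a _; rewrite !scalerA mulrC.
rewrite sE.
have -> : \sum_i \sum_j (v i 0 * w j 0 - v j 0 * w i 0) *: b (E i) (E j) =
    b v w + b v w.
  under eq_bigr => i _ do under eq_bigr => j _ do rewrite scalerBl.
  under eq_bigr => i _ do rewrite sumrB.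
  rewrite sumrB -bE; congr (_ + _); rewrite exchange_big/= -sumrN bE.
  apply: eq_bigr => i _; rewrite -sumrN; apply: eq_bigr => j _.
  by rewrite anti scalerN opprK.
rewrite -(mulr2n (b v w)) -(scaler_nat 2 (b v w)) scalerA.
by rewrite mulVf ?scale1r// pnatr_eq0.
Qed.

Lemma ic_sumP G D (T : Type) (r : seq T) (a : T -> R) d :
  invariant_complement G D -> (forall x, D (d x)) ->
  D (fun v w => \sum_(x <- r) a x *: d x v w).
Proof.
move=> icD Dd; elim: r => [|x r IH].
  rewrite (_ : (fun v w => _) = 0); first exact: ic_0 icD.
  by apply/funext => v; apply/funext => w; rewrite big_nil.
rewrite (_ : (fun v w => _) =
  a x *: d x + (fun v w => \sum_(x <- r) a x *: d x v w)).
  exact: ic_linear icD (a x) _ _ (Dd x) IH.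
by apply/funext => v; apply/funext => w; rewrite big_cons.
Qed.

(* A section of the Spencer operator modulo D, in coordinates. *)
Lemma torsion_correction G D : invariant_complement G D ->
  exists C : 'I_m * 'I_m * 'I_m -> 'cV[R]_m -> 'M[R]_m,
    (forall x, Hom_to (lie_algebra G) (C x)) /\
    forall b, alternating2 b -> D (fun v w => b v w -
      \sum_x (2^-1 * b (delta_mx x.1.1 0) (delta_mx x.1.2 0) x.2 0) *:
        spencer (C x) v w).
Proof.
move=> icD.
pose e (x : 'I_m * 'I_m * 'I_m) (v w : 'cV[R]_m) : 'cV[R]_m :=
  (v x.1.1 0 * w x.1.2 0 - v x.1.2 0 * w x.1.1 0) *: delta_mx x.2 0.
have e_alt x : alternating2 (e x).
  split; last by move=> v; rewrite /e mulrC subrr scale0r.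
  split=> [v|w] a u u'; rewrite /e !mxE scalerA -scalerDl; congr (_ *: _); ring.
(* Only the elementary maps [e x] are decomposed, once and for all; a general [b] is then treated by
   linearity in its coordinates. *)
have Cd_ex x : exists Cd :
      ('cV[R]_m -> 'M[R]_m) * ('cV[R]_m -> 'cV[R]_m -> 'cV[R]_m),
    [/\ Hom_to (lie_algebra G) Cd.1, D Cd.2 &
        forall v w, e x v w = spencer Cd.1 v w + Cd.2 v w].
  have := e_alt x; rewrite (ic_sum icD) => -[_ [N HN <-] [d Dd Nd]].
  by exists (N, d); split=> // v w; rewrite -Nd.
have [Cd CdP] := choice Cd_ex.
exists (fun x => (Cd x).1); split=> [x|b b_alt]; first by case: (CdP x).
rewrite (_ : (fun v w => _) = fun v w => \sum_(x : 'I_m * 'I_m * 'I_m)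
  (2^-1 * b (delta_mx x.1.1 0) (delta_mx x.1.2 0) x.2 0) *: (Cd x).2 v w).
  by apply: ic_sumP icD _ => x; case: (CdP x).
apply/funext => v; apply/funext => w; rewrite (alternating_expand b_alt v w).
rewrite scaler_sumr -sumrB; apply: eq_bigr => x _.
have [_ _ ex] := CdP x.
by rewrite -[_ *: delta_mx _ _]/(e x v w) ex !scalerA scalerDr addrC addKr.
Qed.

End Alternation.

(** * D-connections at a frame *)

Lemma sub_torsion (R : realType) m n (d a a' b b' : 'M[R]_(m, n)) :
  a - a' - (b - b') = - (d + a' - b') + (d + a - b).
Proof. by apply/matrixP => i j; rewrite !mxE; ring. Qed.

Section PointConnection.
Variables (R : realType) (m : nat) (M : smoothManifold R m).
Variables (S : set 'M[R]_m) (P : set (preframe M)).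
Hypothesis GP : G_structure (commutant_group S) P.
Implicit Types (p : preframe M) (c : atlas M) (X Y : frame_tangent M).

Lemma local_section_at p : P p ->
  exists c (U : set M) sigma, [/\ local_section P U sigma, U p.1 & dom c p.1].
Proof.
move=> Pp; have [c cp] := dom_cover p.1.
have [U [sigma [oU Up Ps ss]]] := gs_section GP p.1.
by exists c, U, sigma.
Qed.

(** The fundamental vector of [A] at [p]: the velocity at 0 of p a(x) when a(0) = 1 and a'(0) =
    A. *)
Definition vertical p (A : 'M[R]_m) : frame_tangent M :=
  fun c => (0, p.2 c *m A).

Lemma vertical_compat p A :
  frame_bundle p -> frame_tangent_compat p (vertical p A).
Proof.
move=> fp; split=> [c nc|c c' cp c'p]; rewrite /vertical /=.
  by rewrite (frame_out fp nc) mul0mx.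
rewrite mulmx0 (derive0 (jac (trans c c'))) mul0mx add0r mulmxA.
by rewrite (frame_trans fp cp c'p).
Qed.

(** Its base component is 0, so the flat form of any section takes the value [A] on it. *)
Lemma tangent_vertical p A :
  P p -> commutant S A -> tangent_P P p (vertical p A).
Proof.
move=> Pp cA; have [c [U [sigma [ls Up cp]]]] := local_section_at Pp.
have fp := gs_frames GP Pp.
apply/(tangent_PP GP ls Pp Up cp); split; first exact: vertical_compat.
rewrite /flat_form /vertical /= (derive0 (section_matrix c sigma)).
by rewrite mulmx0 !mul0mx subr0 mulKmx// (frame_unit fp cp).
Qed.

(** Right translation by [B] conjugates the flat form by the inverse of [B], which keeps it in the
    commutant. *)
Lemma tangent_act p B X : P p -> commutant_group S B -> tangent_P P p X ->
  tangent_P P (frame_act p B) (frame_tangent_act X B).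
Proof.
move=> Pp GB; have [uB cB] := GB.
have [c [U [sigma [ls Up cp]]]] := local_section_at Pp.
have PB := gs_act GP Pp GB.
move=> /(tangent_PP GP ls Pp Up cp)[[Xo Xc] fX].
apply/(tangent_PP (p := frame_act p B) GP ls PB Up cp); split.
  split=> [c1 nc|c1 c2 c1p c2p]; rewrite /frame_tangent_act.
    by rewrite (Xo c1 nc) /= mul0mx.
  by rewrite (Xc c1 c2)//= mulmxDl !mulmxA.
have uz := frame_unit (gs_frames GP Pp) cp.
suff -> : flat_form c sigma (frame_act p B) (frame_tangent_act X B) =
   invmx B *m flat_form c sigma p X *m B.
  by apply: commutantM => //; apply: commutantM => //; exact: commutantV.
rewrite /flat_form /frame_act /frame_tangent_act /=.
move: ('D__ _ _) => dS; rewrite mulmxBr mulmxBl.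
by rewrite invmxM// !mulmxA.
Qed.

Lemma solder_linear c p a X Y :
  solder c p (a *: X + Y) = a *: solder c p X + solder c p Y.
Proof. by rewrite /solder /solder_coord /= mulmxDr -scalemxAr. Qed.

(** [H] lifts vectors along the flat connection of a local section, that is, [tangent_lift] with A =
    0. The remainder of a tangent vector is vertical; the coefficient 1 gives the decomposition the
    shape expected by [dc_linear]. *)
Lemma horizontal_lift p : P p -> exists H : 'cV[R]_m -> frame_tangent M,
  [/\ forall v, tangent_P P p (H v), linear H,
      forall c v, dom c p.1 -> solder c p (H v) = v &
      forall c X, dom c p.1 -> tangent_P P p X ->
        exists2 A, commutant S A & X = 1 *: vertical p A + H (solder c p X)].
Proof.
move=> Pp; have [c0 [U [sigma [ls Up cp]]]] := local_section_at Pp.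
have fp := gs_frames GP Pp; have uz := frame_unit fp cp.
have lift v : exists X, tangent_P P p X /\
    X c0 = (p.2 c0 *m v, 'D_(p.2 c0 *m v) (section_matrix c0 sigma)
      (chart c0 p.1) *m
      (invmx (section_matrix c0 sigma (chart c0 p.1)) *m p.2 c0)).
  have [X TX Xc] :=
    tangent_lift GP ls Pp Up cp (p.2 c0 *m v) (@commutant0 _ _ S).
  by exists X; split=> //; rewrite Xc mulmx0 addr0.
have [H HP] := choice lift.
have TH v : tangent_P P p (H v) by case: (HP v).
have Hc v := (HP v).2.
have compat X : tangent_P P p X -> frame_tangent_compat p X.
  exact: tangent_P_compat.
have dS := differentiable_section_matrix ls (section_coord Up cp).
have sH c v : dom c p.1 -> solder c p (H v) = v.
  move=> cp'; rewrite (solder_chart fp cp cp' (compat _ (TH v))).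
  by rewrite /solder /solder_coord /= Hc /= mulKmx.
exists H; split=> //.
  move=> a v w; apply: (compat_inj cp (compat _ (TH _))).
    by apply: compat_linear; exact: compat.
  rewrite Hc [RHS](_ : _ = a *: H v c0 + H w c0)// !Hc.
  apply: injective_projections => /=; first by rewrite mulmxDr -scalemxAr.
  rewrite mulmxDr -scalemxAr (derive_linear a _ _ dS).
  by rewrite mulmxDl -scalemxAl.
move=> c X cp' TX; have /(tangent_PP GP ls Pp Up cp)[cX fX] := TX.
exists (flat_form c0 sigma p X) => //.
apply: (compat_inj cp cX).
  by apply: compat_linear; [exact: vertical_compat|exact: compat].
rewrite [RHS](_ : _ = 1 *: vertical p (flat_form c0 sigma p X) c0 +
   H (solder c p X) c0)// Hc (solder_chart fp cp cp' cX).
rewrite /solder /solder_coord /vertical /= scale1r (mulKVmx uz).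
apply: injective_projections => /=; first by rewrite add0r.
rewrite /flat_form mulmxBr mulKVmx// -!mulmxA (mulKVmx uz).
by rewrite subrK.
Qed.

Variable D : set ('cV[R]_m -> 'cV[R]_m -> 'cV[R]_m).
Hypothesis icD : invariant_complement (commutant_group S) D.
Hypothesis prol0 :
  first_prolongation (lie_algebra (commutant_group S)) = [set 0].

Definition torsion_at p (w : frame_tangent M -> 'M[R]_m)
    (T : 'cV[R]_m -> 'cV[R]_m -> 'cV[R]_m) : Prop :=
  forall c X Y, dom c p.1 -> tangent_P P p X -> tangent_P P p Y ->
    T (solder c p X) (solder c p Y) =
    d_solder c p X Y + w X *m solder c p Y - w Y *m solder c p X.

(** The requirements on a [D]-connection that concern a single frame. Smoothness and equivariance,
    which relate different frames, are left out so that a value can be chosen at each frame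
    separately. *)
Record D_connection_at p (w : frame_tangent M -> 'M[R]_m) : Prop :=
  DConnectionAt {
  dc_lie : forall X, tangent_P P p X -> commutant S (w X);
  dc_linear : forall a X Y, tangent_P P p X -> tangent_P P p Y ->
    w (a *: X + Y) = a *: w X + w Y;
  dc_vertical : forall A, commutant S A -> w (vertical p A) = A;
  dc_torsion : exists2 T, D T & torsion_at p w T }.

Lemma D_connection_at_unique p w w' : P p ->
  D_connection_at p w -> D_connection_at p w' ->
  forall X, tangent_P P p X -> w X = w' X.
Proof.
move=> Pp cw cw'; have [c cp] := dom_cover p.1.
have [H [TH lH sH XH]] := horizontal_lift Pp.
(* The two forms agree on vertical vectors, so their difference is determined on horizontal lifts.
   The exterior derivative of the soldering form is common to both torsions and cancels. *)
pose delta v := w (H v) - w' (H v).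
have gdelta : Hom_to (lie_algebra (commutant_group S)) delta.
  rewrite lie_algebra_commutant; split=> [a u v|v].
    rewrite /delta lH (dc_linear cw)// (dc_linear cw')// scalerBr opprD.
    exact: addrACA.
  apply: commutantD; first exact: dc_lie cw _ (TH v).
  by apply: commutantN; exact: dc_lie cw' _ (TH v).
have [T DT TP] := dc_torsion cw; have [T' DT' TP'] := dc_torsion cw'.
have Dd : D (spencer delta).
  rewrite (_ : spencer delta = -1 *: T' + T).
    exact: ic_linear icD _ _ _ DT' DT.
  apply/funext => u; apply/funext => v.
  rewrite [RHS](_ : _ = -1 *: T' u v + T u v)// scaleN1r.
  rewrite -[in RHS](sH c u cp) -[in RHS](sH c v cp) TP// TP'// !sH//.
  by rewrite /spencer /delta !mulmxBl; exact: sub_torsion.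
have delta0 := spencer_inj prol0 icD gdelta Dd.
move=> X TX; have [A cA ->] := XH c X cp TX.
have TV := tangent_vertical Pp cA.
rewrite (dc_linear cw)// (dc_linear cw')//.
rewrite (dc_vertical cw cA) (dc_vertical cw' cA).
congr (_ + _); apply/eqP; rewrite -subr_eq0; apply/eqP.
exact: (congr1 (fun f => f (solder c p X)) delta0).
Qed.

End PointConnection.

(** For the form kappa + N - c, the [kappa] part cancels against the exterior derivative of the
    soldering form, and the alternation of N - c remains. *)
Lemma torsion_identity (R : realType) m n (kX kY nX nY cX cY : 'M[R]_(m, n)) :
  nX - nY - (cX - cY) = kY - kX + (kX + nX - cX) - (kY + nY - cY).
Proof. by apply/matrixP => i j; rewrite !mxE; ring. Qed.

(** * The local D-connection attached to a section *)

Section Existence.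
Variables (R : realType) (m : nat) (M : smoothManifold R m).
Variables (S : set 'M[R]_m) (P : set (preframe M)).
Variable D : set ('cV[R]_m -> 'cV[R]_m -> 'cV[R]_m).
Hypothesis GP : G_structure (commutant_group S) P.
Implicit Types (p : preframe M) (c : atlas M) (X Y : frame_tangent M).

Section LocalForm.
Variable C : 'I_m * 'I_m * 'I_m -> 'cV[R]_m -> 'M[R]_m.
Hypothesis HomC : forall x, Hom_to (lie_algebra (commutant_group S)) (C x).
Hypothesis correctC : forall b, alternating2 b -> D (fun v w => b v w -
  \sum_x (2^-1 * b (delta_mx x.1.1 0) (delta_mx x.1.2 0) x.2 0) *:
    spencer (C x) v w).
Variables (c0 : atlas M) (U : set M) (sigma : M -> preframe M).
Hypothesis ls : local_section P U sigma.

(** The Spencer image of [section_christoffel] is the torsion of the flat connection; these are its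
    coordinates, with the 1/2 of [alternating_expand]. *)
Definition correction_coeff p (x : 'I_m * 'I_m * 'I_m) : R :=
  2^-1 * spencer (section_christoffel c0 sigma p)
    (delta_mx x.1.1 0) (delta_mx x.1.2 0) x.2 0.

Definition local_form p X : 'M[R]_m := flat_form c0 sigma p X -
  \sum_x correction_coeff p x *: C x (solder c0 p X).

(** The correction is a Lie algebra valued linear function of the soldering form. It vanishes on
    vertical vectors, so their normalisation is kept, and it moves the torsion into [D]. *)
Lemma local_form_D_connection p : P p -> U p.1 -> dom c0 p.1 ->
  D_connection_at S P D p (local_form p).
Proof.
move=> Pp Up cp; have fp := gs_frames GP Pp; have uz := frame_unit fp cp.
have lC x : linear (C x) by case: (HomC x).
have gC x v : commutant S (C x v).
  by rewrite -lie_algebra_commutant; case: (HomC x).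
have compat X : tangent_P P p X -> frame_tangent_compat p X.
  exact: tangent_P_compat.
split.
- move=> X TX; apply: commutantD.
    exact: (tangent_P_flat_form GP ls Pp Up cp TX).
  apply: commutantN; apply: commutant_sum => x; apply: commutantZ; exact: gC.
- move=> a X Y TX TY; rewrite /local_form (flat_form_linear ls Up cp).
  rewrite solder_linear (scalerBr a (flat_form c0 sigma p X)).
  rewrite [RHS]addrACA -opprD; congr (_ - _).
  rewrite scaler_sumr -big_split /=; apply: eq_bigr => x _.
  by rewrite lC scalerDr !scalerA mulrC.
- move=> A cA; rewrite /local_form big1.
    rewrite subr0 /flat_form /vertical /= (derive0 (section_matrix c0 sigma)).
    by rewrite mulmx0 !mul0mx subr0 mulKmx.
  move=> x _; rewrite /solder /solder_coord /= mulmx0.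
  by rewrite (linear_fun0 (lC x)) scaler0.
- have lN := section_christoffel_linear ls Up cp.
  exists (fun v w => spencer (section_christoffel c0 sigma p) v w -
      \sum_x correction_coeff p x *: spencer (C x) v w).
    exact: correctC (spencer_alternating lN).
  move=> c X Y cp' TX TY.
  have cX := compat X TX; have cY := compat Y TY.
  (* The torsion is tested in an arbitrary chart [c], whereas the form is written in [c0]. *)
  rewrite (d_solder_chart fp cp cp' cX cY).
  rewrite !(solder_chart fp cp cp')// d_solderE// /local_form.
  rewrite !(flat_formE GP _ Pp cp).
  set v := solder c0 p X; set w := solder c0 p Y.
  have -> : \sum_x correction_coeff p x *: spencer (C x) v w =
      (\sum_x correction_coeff p x *: C x v) *m w -
      (\sum_x correction_coeff p x *: C x w) *m v.
    rewrite !mulmx_suml -sumrB; apply: eq_bigr => x _.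
    by rewrite /spencer scalerBr -!scalemxAl.
  rewrite /spencer; move: (\sum_x _) (\sum_x _) => Cv Cw.
  move: (section_christoffel c0 sigma p v) (section_christoffel c0 sigma p w).
  by move=> Nv Nw; rewrite !mulmxBl !mulmxDl; exact: torsion_identity.
Qed.

Lemma Ck_linear_fun (E : normedModType R) k (W : set E)
    (L : 'cV[R]_m -> 'M[R]_m) (g : E -> 'cV[R]_m) :
  open W -> linear L -> Ck_on k W g ->
  Ck_on k W (fun x => L (g x)).
Proof.
move=> oW lL gk.
apply: (Ck_on_eq (f := fun x => \sum_i g x i 0 *: L (delta_mx i 0)) oW).
  move=> x _; rewrite -(linear_fun_sum _ _ _ lL); congr L.
  rewrite [RHS](matrix_sum_delta (g x)).
  by apply: eq_bigr => i _; rewrite big_ord1.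
apply: Ck_sum => // i; apply: Ck_scalemx => //; first exact: Ck_entry.
exact: (@Ck_cst _ _ _ _ _ (L (delta_mx i 0))).
Qed.

(** In [c0] the form is built by products, inverses and derivatives from the coordinates of [f] and
    the matrix of the section, while the maps [C x] are constant data. *)
Lemma smooth_local_form (E : normedModType R) (W : set E)
    (f : E -> preframe M) v :
  open W -> smooth_frames W f ->
  (forall w, W w -> [/\ P (f w), U (f w).1 & dom c0 (f w).1]) ->
  smooth_on W (fun w => local_form (f w) (pushforward f w v)).
Proof.
move=> oW sf fP k; have oV := @open_section_dom _ _ _ _ c0 _ _ ls.
have lC x : linear (C x) by case: (HomC x).
have [_ _ /(_ c0) sfc] := sf.
have {}sfc j : Ck_on j W (frame_chart c0 \o f).
  by apply: Ck_onS (sfc j) => w Ww; split=> //; case: (fP w Ww).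
pose y w := chart c0 (f w).1; pose z w := (f w).2 c0.
have sy : Ck_on k W y := Ck_fst oW (sfc k).
have sz : Ck_on k W z := Ck_snd oW (sfc k).
have yV w : W w -> (chart c0 @` (U `&` dom c0)) (y w).
  by move=> /fP[Pw Uw cw]; exists (f w).1.
have uz w : W w -> z w \in unitmx.
  by move=> /fP[Pw Uw cw]; exact: frame_unit (gs_frames GP Pw) cw.
have szi : Ck_on k W (fun w => invmx (z w)) by exact: Ck_invmx.
(* The push-forward costs one derivative of [f], hence order [k.+1]. *)
have sh : Ck_on k W (fun w => pushforward f w v c0).
  have [_ /(_ v)] := sfc k.+1; apply: Ck_on_eq => // w /fP[_ _ cw].
  by rewrite (pushforwardE v cw).
have sS := smooth_section_matrix c0 ls.
have sSi : Ck_on k W (fun w => invmx (section_matrix c0 sigma (y w))).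
  apply: Ck_invmx => //.
    by move=> w /yV Vw; exact: (section_matrix_unit GP ls Vw).
  exact: (Ck_comp oW oV yV sy (sS k)).
have sdS u : Ck_on k W u ->
    Ck_on k W (fun w => 'D_(u w) (section_matrix c0 sigma) (y w)).
  by move=> su; apply: (Ck_derive_along oW oV yV sy su); exact: sS.
have sconj u : Ck_on k W u -> Ck_on k W (fun w => invmx (z w) *m
    'D_(u w) (section_matrix c0 sigma) (y w) *m
    invmx (section_matrix c0 sigma (y w)) *m z w).
  by move=> su; do 3![apply: Ck_mulmx => //]; exact: sdS.
have sN u : Ck_on k W (fun w => section_christoffel c0 sigma (f w) u).
  apply: Ck_opp => //; apply: sconj; apply: Ck_mulmx => //.
  exact: (@Ck_cst _ _ _ _ _ u).
have sth : Ck_on k W (fun w => solder c0 (f w) (pushforward f w v)).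
  by apply: Ck_mulmx => //; exact: Ck_fst.
apply: Ck_add => //.
  apply: Ck_add => //; first by apply: Ck_mulmx => //; exact: Ck_snd.
  by apply: Ck_opp => //; apply: sconj; exact: Ck_fst.
apply: Ck_opp => //; apply: Ck_sum => // x; apply: Ck_scalemx => //.
  apply: Ck_mul => //; first exact: (@Ck_cst _ _ _ _ _ (2^-1 : R)).
  apply: (@Ck_entry _ _ _ _ _ _
    (fun w => spencer (section_christoffel c0 sigma (f w))
     (delta_mx x.1.1 0) (delta_mx x.1.2 0))) => //.
  apply: Ck_add => //; first by apply: Ck_mulmx => //; exact: Ck_cst.
  by apply: Ck_opp => //; apply: Ck_mulmx => //; exact: Ck_cst.
by apply: Ck_linear_fun.
Qed.

End LocalForm.
End Existence.

(** * The global D-connection *)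

Section GlobalConnection.
Variables (R : realType) (m : nat) (M : smoothManifold R m).
Variables (S : set 'M[R]_m) (P : set (preframe M)).
Variable D : set ('cV[R]_m -> 'cV[R]_m -> 'cV[R]_m).
Hypothesis GP : G_structure (commutant_group S) P.
Hypothesis icD : invariant_complement (commutant_group S) D.
Hypothesis prol0 :
  first_prolongation (lie_algebra (commutant_group S)) = [set 0].
Implicit Types (p : preframe M) (c : atlas M) (X Y : frame_tangent M).

(** Tangent vectors are velocities of curves, so [f] is restricted to the line w + xv. *)
Lemma pushforward_tangent d (W : set 'cV[R]_d)
    (f : 'cV[R]_d -> preframe M) w v :
  open W -> W w -> smooth_frames W f -> (forall w, W w -> P (f w)) ->
  tangent_P P (f w) (pushforward f w v).
Proof.
move=> oW Ww sf fP; pose l (x : R^o) := w + x *: v.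
have lc x : {for x, continuous l}.
  exact/differentiable_continuous/differentiable_line.
have oV : open (l @^-1` W) by apply: open_comp oW => x _; exact: lc.
have l0 : l 0 = w by rewrite /l scale0r addr0.
exists (l @^-1` W), (f \o l); split; last first.
- apply/funext => c; have [cw|nw] := pselect (dom c (f w).1); last first.
    by rewrite /pushforward !asboolF//= l0.
  have cl : dom c ((f \o l) 0).1 by rewrite /= l0.
  rewrite (pushforwardE v cw) (pushforwardE (1 : R^o) cl).
  have dl : differentiable l 0 := differentiable_line w v 0.
  have Dl : 'D_(1 : R^o) l 0 = v := derive_line w v 0.
  have df : differentiable (frame_chart c \o f) (l 0).
    by rewrite l0; exact: (differentiable_frames sf).
  apply: esym; apply: etrans (derive_comp (1 : R^o) dl df) _.
  by rewrite Dl l0.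
- by move=> x /fP.
split=> //; first by rewrite /= l0.
  have [ff fc fs] := sf; split=> [x /ff //|x Wx|c k].
    by apply: (@continuous_comp _ _ _ l (fst \o f)); [exact: lc|exact: fc].
  have oWc := open_frames_dom c oW sf.
  have oVc : open (l @^-1` (W `&` [set w | dom c (f w).1])).
    by apply: open_comp oWc => x _; exact: lc.
  have sl : Ck_on k (l @^-1` (W `&` [set w | dom c (f w).1])) l.
    exact: Ck_line.
  apply: (@Ck_pair _ _ _ _ k _ (fun x => chart c (f (l x)).1)
           (fun x => (f (l x)).2 c)) => //.
    exact: (Ck_comp oVc oWc _ sl (Ck_fst oWc (fs c k))).
  exact: (Ck_comp oVc oWc _ sl (Ck_snd oWc (fs c k))).
by rewrite /= l0.
Qed.

Lemma pushforward_vertical p a : P p -> curve_at1 (commutant_group S) a ->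
  pushforward (fun x => frame_act p (a x)) 0 (1 : R^o) =
  vertical p ('D_(1 : R^o) a 0).
Proof.
move=> Pp [a0 [W [oW W0 sa _]]]; have fp := gs_frames GP Pp.
apply/funext => c; rewrite /pushforward /vertical /=.
case: asboolP => cp; last by rewrite (frame_out fp cp) mul0mx.
have [/(_ 0 W0) da _] := sa 1%N.
have dc : differentiable (cst (chart c p.1) : R^o -> 'cV[R]_m) 0.
  exact: differentiable_cst.
have dp : differentiable (fun x => p.2 c *m a x) 0.
  by apply: differentiable_mulmx.
apply: etrans (derive_pair (1 : R^o) dc dp) _.
apply: injective_projections => /=; first exact: derive_cst.
exact: derive_mulmxl.
Qed.

(** Pulling [w] back by the right translation and conjugating by [B] turns its torsion T into B
    T(B^-1 v, B^-1 u), which the invariance of [D] keeps in [D]. Equivariance of the connection will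
    follow from uniqueness at [p]. *)
Lemma D_connection_at_act p B w : P p -> commutant_group S B ->
  D_connection_at S P D (frame_act p B) w ->
  D_connection_at S P D p
    (fun X => B *m w (frame_tangent_act X B) *m invmx B).
Proof.
move=> Pp GB [wl wlin wv [T DT TP]]; have [uB cB] := GB.
have fp := gs_frames GP Pp.
have tB X : tangent_P P p X ->
    tangent_P P (frame_act p B) (frame_tangent_act X B).
  exact: (tangent_act GP Pp GB).
have invM c : dom c p.1 -> invmx (p.2 c *m B) = invmx B *m invmx (p.2 c).
  by move=> cp; rewrite invmxM// (frame_unit fp cp).
split.
- move=> X TX; apply: commutantM; last exact: commutantV.
  by apply: commutantM => //; exact/wl/tB.
- move=> a X Y TX TY.
  have -> : frame_tangent_act (a *: X + Y) B =
            a *: frame_tangent_act X B + frame_tangent_act Y B.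
    apply/funext => c; rewrite /frame_tangent_act.
    apply: injective_projections => //=.
    by rewrite mulmxDl -scalemxAl.
  rewrite wlin; [|exact: tB|exact: tB].
  by rewrite mulmxDr mulmxDl -scalemxAr -scalemxAl.
- move=> A cA.
  have -> : frame_tangent_act (vertical p A) B =
            vertical (frame_act p B) (invmx B *m A *m B).
    apply/funext => c; rewrite /frame_tangent_act /vertical /=; congr pair.
    by rewrite !mulmxA mulmxK.
  rewrite wv; last first.
    by do ?[apply: commutantM => //]; exact: commutantV.
  by rewrite !mulmxA mulmxV// mul1mx mulmxK.
- exists (fun v u => B *m T (invmx B *m v) (invmx B *m u)).
    exact: (ic_invariant icD).
  move=> c X Y cp TX TY; have uz := frame_unit fp cp.
  have sB Z : invmx B *m solder c p Z =
      solder c (frame_act p B) (frame_tangent_act Z B).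
    by rewrite /solder /solder_coord /= invM// mulmxA.
  have kB Z : kappa c (frame_act p B) (frame_tangent_act Z B) =
      invmx B *m kappa c p Z *m B.
    by rewrite /kappa /= invM// !mulmxA.
  rewrite !sB TP//; [|exact: tB|exact: tB].
  rewrite !d_solderE//; last by rewrite unitmx_mul uz.
  rewrite !kB -!sB !mulmxDr !mulmxN.
  rewrite -!mulmxA !(mulKVmx uB) !mulmxA.
  by [].
Qed.

Lemma exists_unique_D_connection :
  exists2 omega, D_connection (commutant_group S) P D omega &
    forall omega', D_connection (commutant_group S) P D omega' ->
      same_on P omega omega'.
Proof.
have [C [HomC correctC]] := torsion_correction icD.
have exw p : exists w, P p -> D_connection_at S P D p w.
  (* Outside [P] the value 0 is a mere default. *)
  have [Pp|nPp] := pselect (P p); last by exists (fun=> 0).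
  have [c [U [sigma [ls Up cp]]]] := local_section_at GP Pp.
  exists (local_form C c sigma p) => _.
  exact: (local_form_D_connection GP HomC correctC ls Pp Up cp).
have [omega omegaP] := choice exw.
exists omega; last first.
  move=> omega' [[lie lin _ fund _] [T TP DT]] p X Pp TX.
  apply: (D_connection_at_unique GP icD prol0 Pp (omegaP p Pp)) => //.
  split.
  - by move=> Y TY; rewrite -lie_algebra_commutant; exact: lie.
  - by move=> a Y Z TY TZ; exact: lin.
  (* Every element of the Lie algebra is the velocity of a curve in the group, so the condition on
     fundamental vectors covers all vertical vectors. *)
  - move=> A; rewrite -lie_algebra_commutant => -[a Ga <-].
    by rewrite -(pushforward_vertical Pp Ga); exact: fund.
  - by exists (T p); [exact: DT|move=> c Y Z cp TY TZ; exact: TP].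
split.
  split.
  - move=> p X Pp TX; rewrite lie_algebra_commutant.
    exact: (dc_lie (omegaP p Pp)).
  - by move=> p a X Y Pp TX TY; exact: (dc_linear (omegaP p Pp)).
  (* The choice of [omega] carries no regularity from frame to frame. Near a given point one section
     serves all frames, and by uniqueness [omega] equals its smooth local form there. *)
  - move=> d W f v oW sf fP k; apply: Ck_on_local => w Ww.
    have [c [U [sigma [ls Uw cw]]]] := local_section_at GP (fP w Ww).
    pose W' := W `&` [set w | U (f w).1 /\ dom c (f w).1].
    have oW' : open W'.
      rewrite openE => x [Wx [Ux cx]]; have [oU _ _] := ls.
      have n1 := near_dom oW Wx sf cx.
      have n2 : \forall y \near x, U (f y).1.
        have [_ /(_ x Wx) fc _] := sf; apply: (fc U).
        exact: open_nbhs_nbhs.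
      by apply: filterS2 n1 n2 => y [].
    have W'W : W' `<=` W by move=> x [].
    have sf' : smooth_frames W' f.
      have [ff fc fs] := sf; split=> [x /W'W/ff //|x /W'W/fc //|c' j].
      by apply: Ck_onS (fs c' j) => x [/W'W].
    have fP' x : W' x -> [/\ P (f x), U (f x).1 & dom c (f x).1].
      by move=> [Wx [Ux cx]]; split=> //; exact: fP.
    exists W'; first by split.
    apply: Ck_on_eq oW' _ (smooth_local_form GP HomC ls v oW' sf' fP' k).
    move=> x W'x; have [Px Ux cx] := fP' x W'x; apply/esym.
    apply: (D_connection_at_unique GP icD prol0 Px (omegaP _ Px)).
      exact: (local_form_D_connection GP HomC correctC ls Px Ux cx).
    exact: (pushforward_tangent v oW (W'W x W'x) sf fP).
  - move=> p a Pp Ga; rewrite (pushforward_vertical Pp Ga).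
    apply: (dc_vertical (omegaP p Pp)).
    by rewrite -lie_algebra_commutant; exists a.
  (* The value at the translated frame, transported back to [p], is a second solution there and
     hence equals [omega p]. *)
  - move=> p B X Pp GB TX; have [uB _] := GB.
    have := D_connection_at_unique GP icD prol0 Pp (omegaP p Pp)
      (D_connection_at_act Pp GB (omegaP _ (gs_act GP Pp GB))) TX.
    by move=> ->; rewrite !mulmxA mulVmx// mul1mx mulmxKV.
have exT p : exists T, P p -> D T /\ torsion_at P p (omega p) T.
  have [Pp|nPp] := pselect (P p); last by exists 0.
  by have [T DT TP] := dc_torsion (omegaP p Pp); exists T.
have [T TP] := choice exT.
exists T; last by move=> p /TP[].
by move=> p c X Y Pp cp TX TY; have [_] := TP p Pp; exact.
Qed.

End GlobalConnection.

(** * Almost Clifford structures *)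

Theorem corollary4p8 (R : realType) (s t n : nat) (A : falgType R)
    (I : 'I_t -> A) (J : 'I_s -> A) (e : (2 ^ (s + t)).-tuple A)
    (M : smoothManifold R (n * 2 ^ (s + t))) (P : set (preframe M))
    (D : set ('cV[R]_(n * 2 ^ (s + t)) -> 'cV[R]_(n * 2 ^ (s + t)) ->
              'cV[R]_(n * 2 ^ (s + t)))) :
  (1 < s + t)%N -> (0 < n)%N ->
  is_clifford I J -> basis_of {:A}%VS e ->
  G_structure (GL_clifford I J e n) P ->
  invariant_complement (GL_clifford I J e n) D ->
  of_type1 (GL_clifford I J e n) /\
  exists2 omega, D_connection (GL_clifford I J e n) P D omega &
    forall omega', D_connection (GL_clifford I J e n) P D omega' ->
      same_on P omega omega'.
Proof.
move=> st n0 cl be GP icD.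
have type1 : of_type1 (GL_clifford I J e n).
  by apply: GL_clifford_type1 => //; rewrite muln_gt0 n0 expn_gt0.
split=> //; have [prol0 _] := type1.
rewrite GL_cliffordE in GP icD prol0 *.
exact: exists_unique_D_connection GP icD prol0.
Qed.
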